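(* There exists a positive constant $C$ such that for all integers $n\ge2$ and $2\le m\le n-4$, if $$\mu=\sigma_n^2-2\langle\sigma_n^2-\mu_n\rangle,\qquad a=\langle\sigma_n^2-\mu_n\rangle,\qquad c=\lfloor\sigma_n^2-\mu_n\rfloor,$$ then $$d_{\mathrm{TV}}\big(\mathcal D(W_{n,m}+c),\pi_{\mu,a}\big)\le\frac C{\sigma_n}\left(\frac{\lfloor\sigma_n^2-[\mu_n-(n-m)]\rfloor}{\sigma_n^2}+\frac{(n-m)^2}{nm}\right).$$
   Context: Coupon collector's waiting time: coupons are drawn independently and uniformly at random with replacement from $n$ distinct coupons, and $W_{n,m}$ is the number of draws until $n-m$ distinct coupons have been collected for the first time. Equivalently, $W_{n,m}$ is distributed as a sum of independent geometric random variables (on $\{1,2,\ldots\}$) with success probabilities $k/n$, $k=m+1,\ldots,n$. Its mean and variance are $\mu_n=n\sum_{k=m+1}^n\frac1k$ and $\sigma_n^2=n\sum_{k=m+1}^n\frac{n-k}{k^2}$. $\langle x\rangle$ and $\lfloor x\rfloor$ denote the fractional and integer part of $x$. $\pi_{\mu,a}$ denotes the distribution of $Z_1+2Z_2$, where $Z_1\sim\mathrm{Po}(\mu)$ and $Z_2\sim\mathrm{Po}(a/2)$ are independent Poisson random variables ($\mathrm{Po}(0)$ being the point mass at $0$). $\mathcal D(X)$ is the distribution of $X$, and $d_{\mathrm{TV}}(\mu,\nu)=\sup_B|\mu(B)-\nu(B)|$ over Borel sets $B\subset\mathbb{R}$. *)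

(* Defs.v *)
From HB Require Import structures.
From mathcomp Require Import all_boot all_order all_algebra.
From mathcomp Require Import all_classical all_reals all_analysis.
From mathcomp Require Import measurable_realfun.

Set Implicit Arguments.
Unset Strict Implicit.
Unset Printing Implicit Defensive.

Import Order.TTheory GRing.Theory Num.Theory.

Local Open Scope classical_set_scope.
Local Open Scope ring_scope.

Definition dTV (R : realType) (mu nu : probability R R) :
    \bar R :=
  ereal_sup [set `|mu B - nu B|%E | B in measurable].

Definition mutually_independent (R : realType) (d d' : measure_display)
    (T : measurableType d) (T' : measurableType d') (I : choiceType)
    (P : probability T R) (X : I -> {RV P >-> T'}) : Prop :=
  forall (s : seq I) (A : I -> set T'),
    uniq s -> (forall i, measurable (A i)) ->
    P (\bigcap_(i in [set` s]) (X i @^-1` A i)) =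
    (\prod_(i <- s) P (X i @^-1` A i))%E.

(* The n coupons carry the labels 0, ..., n - 1; X i is the label obtained at
   draw number i + 1. *)
Definition coupon_draws (R : realType) (d : measure_display)
    (T : measurableType d) (P : probability T R) (n : nat)
    (X : nat -> {RV P >-> nat}) : Prop :=
  mutually_independent X /\
  (forall i k : nat,
     P (X i @^-1` [set k]) = (if (k < n)%N then n%:R^-1 else 0)%:E).

Definition num_distinct (x : nat -> nat) (t : nat) : nat :=
  size (undup (mkseq x t)).

(* If r distinct values are never reached the waiting time is set to 0; for
   coupon draws and r <= n this event has probability 0. *)
Definition first_time (x : nat -> nat) (r : nat) : nat :=
  if pselect (exists t, num_distinct x t == r) is left e then ex_minn e
  else 0%N.

Definition waiting_time (R : realType) (d : measure_display)
    (T : measurableType d) (P : probability T R)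
    (X : nat -> {RV P >-> nat}) (n m : nat) (w : T) : R :=
  (first_time (fun i => X i w) (n - m))%:R.

Section measurability.
Context (R : realType) (d : measure_display) (T : measurableType d)
  (P : probability T R) (X : nat -> {RV P >-> nat}) (n m : nat).

Lemma measurable_word (t : nat) (Q : pred (seq nat)) :
  measurable [set w | Q (mkseq (fun i => X i w) t)].
Proof.
elim: t Q => [|t IH] Q.
  have [Q0|Q0] := boolP (Q [::]).
    by rewrite (_ : mkset _ = setT)//; apply/seteqP; split.
  by rewrite (_ : mkset _ = set0)//; apply/seteqP; split => // w /= /(negP Q0).
rewrite (_ : mkset _ = \bigcup_(k in setT)
    (X t @^-1` [set k] `&`
     [set w | [pred s | Q (rcons s k)] (mkseq (fun i => X i w) t)])).
  apply: bigcup_measurable => k _; apply: measurableI; last exact: IH.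
  by rewrite -[X in measurable X]setTI; exact: measurable_funP.
apply/seteqP; split => [w /=|w [k _] /= [<-]]; rewrite mkseqS => // Qw.
by exists (X t w).
Qed.

Lemma measurable_first_time (r : nat) :
  measurable_fun setT (fun w => first_time (fun i => X i w) r).
Proof.
pose A t := [set w | num_distinct (fun i => X i w) t == r].
have mA t : measurable (A t).
  exact: (measurable_word t [pred s | size (undup s) == r]).
have mU D : measurable (\bigcup_(j in D) A j) by apply: bigcup_measurable.
move=> _ B _; rewrite setTI.
rewrite (_ : _ @^-1` B = \bigcup_(t in B)
    ((A t `\` \bigcup_(j in [set j | (j < t)%N]) A j) `|`
     (if t == 0%N then ~` \bigcup_(j in setT) A j else set0))).
  apply: bigcup_measurable => t _; apply: measurableU.
    by apply: measurableD.
  by case: ifP => _ //; apply: measurableC.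
apply/seteqP; split => [w /= Bw|w [t Bt]].
  exists (first_time (fun i => X i w) r) => //; move: Bw.
  rewrite /first_time; case: pselect => [e _|ne _]; last first.
    by right => /= -[j _ Aj]; apply: ne; exists j.
  left; case: ex_minnP => k Ak mink; split => // -[j /= jk Aj].
  by have := mink _ Aj; rewrite leqNgt jk.
case => [[At nA]|]; rewrite /preimage /first_time /=.
  case: pselect => [e|[]]; last by exists t.
  case: ex_minnP => k Ak mink; have kt := mink _ At.
  suff -> : k = t by [].
  apply/eqP; rewrite eqn_leq kt leqNgt; apply/negP => ltkt.
  by apply: nA; exists k.
case: eqP => // t0 nA; case: pselect => [[j Aj]|_]; last by rewrite -t0.
by exfalso; apply: nA; exists j.
Qed.

Lemma measurable_waiting_time : measurable_fun setT (waiting_time X n m).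
Proof. exact: measurableT_comp (measurable_first_time (n - m)). Qed.

HB.instance Definition _ := isMeasurableFun.Build _ _ _ _
  (waiting_time X n m) measurable_waiting_time.

End measurability.

Definition coupon_mean (R : realType) (n m : nat) : R :=
  n%:R * \sum_(m.+1 <= k < n.+1) k%:R^-1.

Definition coupon_variance (R : realType) (n m : nat) : R :=
  n%:R * \sum_(m.+1 <= k < n.+1) ((n%:R - k%:R) / k%:R ^+ 2).

Definition floorR (R : realType) (x : R) : R := (Num.floor x)%:~R.

Definition fracR (R : realType) (x : R) : R := x - floorR x.

Definition sum_twice (R : realType) (z : nat * nat) : R :=
  (z.1 + 2 * z.2)%N%:R.

Lemma measurable_sum_twice (R : realType) : measurable_fun setT (@sum_twice R).
Proof.
have mfst : measurable_fun setT (fun z : nat * nat => z.1%:R : R).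
  exact: (measurableT_comp (f := fun k : nat => k%:R : R)).
have msnd : measurable_fun setT (fun z : nat * nat => z.2%:R : R).
  exact: (measurableT_comp (f := fun k : nat => k%:R : R)).
rewrite (_ : @sum_twice R = (fun z => z.1%:R + 2 * z.2%:R)).
  by apply: measurable_funD => //; apply: measurable_funM.
by apply/funext => z; rewrite /sum_twice natrD natrM.
Qed.

HB.instance Definition _ (R : realType) := isMeasurableFun.Build _ _ _ _
  (@sum_twice R) (@measurable_sum_twice R).

(* poisson_prob ignores its second argument, and poisson_prob 0 is the point
   mass at 0. *)
Definition pi_law (R : realType) (mu a : R) : probability R R :=
  distribution (poisson_prob mu 0 \x poisson_prob (a / 2) 0)%E (@sum_twice R).

(* Main.v *)
(* A geometric variable G_x on {0, 1, ...} with mean x has generating function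
   1 / (1 - x w), where w = z - 1.  Up to the shift by n - m, the waiting time is
   the sum of the G_x with x = n/k - 1, m < k <= n.  With M the sum of the x and f, a
   the integer and fractional parts of the sum of the x^2, the family
     F(t) = (1 + t w)^f prod 1 / (1 - t x w) exp((1 - t)(M + f) w + (1 - t^2)(a/2) w^2)
   joins pi_{mu,a} at t = 0 to the law of W + c at t = 1, and the choice of f and a
   cancels the terms in w and w^2 of the logarithmic derivative: F'(t) is t^2 w^3
   times products of factors of bounded l1 norm, with total weight f plus the sum of
   the x^3.  So it suffices to bound the l1 norm of w^3 times the remaining factors by
   a constant times sigma^-3.  For t <= 1/2 the Poisson factor, split in three, does
   this.  For t >= 1/2 one uses a positive fraction of the min(m, n - m) factors with
   the largest means: they are all divisible by a common geometric G_y, and powers of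
   G_y are again smooth.  In both cases the l1 norm of w h is estimated through the
   second moment of the score function of the law. *)
From HB Require Import structures.
Require Import Defs.
From mathcomp Require Import all_boot all_order all_algebra.
From mathcomp Require Import all_classical all_reals all_analysis.
From mathcomp Require Import measurable_realfun.
From mathcomp Require Import ring lra zify.

Set Implicit Arguments.
Unset Strict Implicit.
Unset Printing Implicit Defensive.

Import Order.TTheory GRing.Theory Num.Theory.
Import numFieldNormedType.Exports.

Local Open Scope ring_scope.

(** * Convolution algebra of sequences *)

(** Generating functions as coefficient sequences, under a separate name so that multiplication is
    convolution rather than the pointwise product. *)
Definition fps (R : realType) := nat -> R.

Section fps_ring.
Context (R : realType).
Implicit Types (f g h : fps R) (c : R) (i j : nat).

Definition fps_mul f g : fps R := fun j => \sum_(i < j.+1) f i * g (j - i)%N.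

Definition fps_const c : fps R := fun j => if j == 0%N then c else 0.

Definition fps_trunc (n : nat) f : {poly R} := \poly_(i < n) f i.

Lemma fps_truncE n f i : (i < n)%N -> (fps_trunc n f)`_i = f i.
Proof. by move=> lt_in; rewrite coef_poly lt_in. Qed.

(** A coefficient of a product involves finitely many coefficients of the factors, so the ring laws
    transfer from polynomials. *)
Lemma fps_mul_coef n f g i : (i < n)%N ->
  fps_mul f g i = (fps_trunc n f * fps_trunc n g)`_i.
Proof.
move=> lt_in; rewrite coefM; apply: eq_bigr => -[j /= lt_ji] _.
by rewrite !fps_truncE ?(leq_ltn_trans (leq_subr _ _))// (leq_trans lt_ji).
Qed.

Lemma fps_mulC : commutative fps_mul.
Proof.
by move=> f g; apply/funext => j; rewrite !(fps_mul_coef _ _ (ltnSn j)) mulrC.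
Qed.

Lemma fps_mulA : associative fps_mul.
Proof.
have coef3 f g h j : fps_mul (fps_mul f g) h j =
    (fps_trunc j.+1 f * fps_trunc j.+1 g * fps_trunc j.+1 h)`_j.
  rewrite coefM; apply: eq_bigr => -[i /= lt_ij] _.
  by rewrite (fps_mul_coef _ _ lt_ij) fps_truncE// ltnS leq_subr.
move=> f g h; apply/funext => j; rewrite fps_mulC !coef3.
by rewrite mulrC mulrA.
Qed.

Lemma fps_mul1 : left_id (fps_const 1) fps_mul.
Proof.
move=> f; apply/funext => j; rewrite /fps_mul big_ord_recl /= subn0 mul1r.
by rewrite big1 ?addr0// => i _; rewrite mul0r.
Qed.

HB.instance Definition _ := GRing.Zmodule.copy (fps R) (nat -> R).

Lemma fps_mulDl : left_distributive fps_mul +%R.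
Proof.
move=> f g h; apply/funext => j.
rewrite [RHS](_ : _ = fps_mul f h j + fps_mul g h j)// /fps_mul -big_split /=.
by apply: eq_bigr => i _; rewrite -mulrDl.
Qed.

Lemma fps_1_neq0 : fps_const 1 != 0 :> fps R.
Proof.
apply/eqP => /(congr1 (fun f : fps R => f 0%N)) /eqP.
by rewrite /fps_const /= oner_eq0.
Qed.

HB.instance Definition _ := GRing.Zmodule_isComNzRing.Build (fps R)
  fps_mulA fps_mulC fps_mul1 fps_mulDl fps_1_neq0.

Lemma fpsM f g j : (f * g) j = \sum_(i < j.+1) f i * g (j - i)%N.
Proof. by []. Qed.

Lemma fpsD f g j : (f + g) j = f j + g j.
Proof. by []. Qed.

Lemma fpsN f j : (- f) j = - f j.
Proof. by []. Qed.

Lemma fpsB f g j : (f - g) j = f j - g j.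
Proof. by []. Qed.

Lemma fps0 j : (0 : fps R) j = 0.
Proof. by []. Qed.

Lemma fps1 j : (1 : fps R) j = (j == 0%N)%:R.
Proof. by rewrite /GRing.one /= /fps_const; case: eqP. Qed.

Lemma fps_constM c f j : (fps_const c * f) j = c * f j.
Proof.
rewrite fpsM big_ord_recl /= subn0 big1 ?addr0// => i _.
by rewrite /fps_const /= mul0r.
Qed.

Lemma fps_const_is_zmod_morphism : zmod_morphism fps_const.
Proof.
move=> c c'; apply/funext => -[|j]//=; rewrite fpsB/= /fps_const/= ?subrr//.
Qed.

Lemma fps_const_is_monoid_morphism : monoid_morphism fps_const.
Proof.
split=> // c c'; apply/funext => j; rewrite fps_constM /fps_const.
by case: eqP; rewrite ?mulr0.
Qed.

HB.instance Definition _ := GRing.isZmodMorphism.Build R (fps R) fps_const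
  fps_const_is_zmod_morphism.
HB.instance Definition _ := GRing.isMonoidMorphism.Build R (fps R) fps_const
  fps_const_is_monoid_morphism.

Definition fpsX : fps R := fun j => (j == 1%N)%:R.

Lemma fpsXM f j : (fpsX * f) j = if j is i.+1 then f i else 0.
Proof.
rewrite fpsM; case: j => [|j]; first by rewrite big_ord1 /fpsX mul0r.
rewrite 2!big_ord_recl /= /fpsX mul0r add0r mul1r subSS subn0 big1 ?addr0// => i _.
by rewrite /= mul0r.
Qed.

(** The variable w = z - 1. Multiplying by it takes differences of consecutive coefficients, so the
    norm of [fpsW * h] measures the smoothness of h. *)
Definition fpsW : fps R := fpsX - 1.

Lemma fpsWM f j : (fpsW * f) j = (if j is i.+1 then f i else 0) - f j.
Proof. by rewrite /fpsW mulrBl mul1r fpsB fpsXM. Qed.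

End fps_ring.
Arguments fpsX {R}.
Arguments fpsW {R}.

(** * Bounds on the l1 norm *)

Section l1_norm.
Context (R : realType).
Implicit Types (f g h : fps R) (A B c : R).

(** Bounding all partial sums expresses the norm bound without a summability side condition. *)
Definition l1_le f B := forall n, \sum_(j < n) `|f j| <= B.

Lemma l1_le_ge0 f B : l1_le f B -> 0 <= B.
Proof. by move=> /(_ 0%N); rewrite big_ord0. Qed.

Lemma l1_le_trans f A B : A <= B -> l1_le f A -> l1_le f B.
Proof. by move=> AB fA n; exact: le_trans (fA n) AB. Qed.

Lemma l1_leD f g A B : l1_le f A -> l1_le g B -> l1_le (f + g) (A + B).
Proof.
move=> fA gB n; apply: le_trans (lerD (fA n) (gB n)).
by rewrite -big_split ler_sum// => j _; exact: ler_normD.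
Qed.

(** After exchanging the sums over i <= j < n, each inner sum is a partial sum of the norm of g, of
    length n - i. *)
Lemma l1_leM f g A B : l1_le f A -> l1_le g B -> l1_le (f * g) (A * B).
Proof.
move=> fA gB n.
have -> : \sum_(j < n) `|(f * g) j| = \sum_(0 <= j < n) `|(f * g) j|.
  by rewrite big_mkord.
have step : \sum_(0 <= j < n) `|(f * g) j| <=
    \sum_(0 <= j < n) \sum_(0 <= i < n | (i <= j)%N) `|f i| * `|g (j - i)%N|.
  rewrite !big_nat; apply: ler_sum => j /= lt_jn; rewrite fpsM.
  apply: le_trans (ler_norm_sum _ _ _) _.
  rewrite -(big_mkord xpredT (fun i => `|f i * g (j - i)%N|)).
  rewrite (@big_nat_widen _ _ _ 0%N j.+1 n)// ler_sum// => i _.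
  by rewrite normrM.
apply: le_trans step _; rewrite (exchange_big_dep xpredT)//=.
apply: (@le_trans _ _ (\sum_(0 <= i < n) `|f i| * B)); last first.
  by rewrite -mulr_suml ler_wpM2r ?(l1_le_ge0 gB)// big_mkord.
apply: ler_sum => i _; rewrite -mulr_sumr ler_wpM2l//.
apply: le_trans (gB (n - i)%N).
have [le_in|lt_ni] := leqP i n; last first.
  rewrite big_nat_cond big1 ?sumr_ge0// => j /andP[/andP[_ lt_jn] le_ij].
  by move: (leq_ltn_trans le_ij lt_jn); rewrite ltnNge (ltnW lt_ni).
rewrite (big_cat_nat (leq0n i) le_in) /= big_nat_cond big1 ?add0r; last first.
  by move=> j /andP[/andP[_ lt_ji]]; rewrite leqNgt lt_ji.
rewrite -{1}[i]add0n big_addn big_mkord big_mkcond/= ler_sum// => j _.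
by case: ifP => // _; rewrite addnK.
Qed.

Lemma l1_le_const c : l1_le (fps_const c) `|c|.
Proof.
case=> [|n]; first by rewrite big_ord0.
rewrite big_ord_recl /= /fps_const /= big1 ?addr0// => i _.
by rewrite normr0.
Qed.

Lemma l1_le1 : l1_le (1 : fps R) 1.
Proof. by have := l1_le_const (1 : R); rewrite normr1. Qed.

Lemma l1_le_constM c f B : l1_le f B -> l1_le (fps_const c * f) (`|c| * B).
Proof. by move=> fB; apply: l1_leM fB; exact: l1_le_const. Qed.

Lemma l1_leX : l1_le (fpsX : fps R) 1.
Proof.
case=> [|[|n]]; first by rewrite big_ord0.
  by rewrite big_ord1 /fpsX normr0.
rewrite 2!big_ord_recl /= /fpsX normr0 add0r normr1 big1 ?addr0//.
Qed.

Lemma l1_leW : l1_le (fpsW : fps R) 2.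
Proof.
have := l1_leD l1_leX (l1_le_const (-1 : R)).
by rewrite rmorphN1 normrN1.
Qed.

Lemma l1_le_sum_seq (I : Type) (s : seq I) (Q : pred I) (F : I -> fps R) (B : I -> R) :
  (forall i, Q i -> l1_le (F i) (B i)) ->
  l1_le (\sum_(i <- s | Q i) F i) (\sum_(i <- s | Q i) B i).
Proof.
move=> FB; elim/big_ind2 : _ => [n|f A g B' fA gB|]; last exact: FB.
- by rewrite big1// => j _; rewrite normr0.
- exact: l1_leD.
Qed.

Lemma l1_leXn f n : l1_le f 1 -> l1_le (f ^+ n) 1.
Proof.
move=> f1; elim: n => [|n IH]; first exact: l1_le1.
by rewrite exprS -[1]mulr1; exact: l1_leM.
Qed.

Lemma fpsM_ge0 f g : (forall j, 0 <= f j) -> (forall j, 0 <= g j) ->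
  forall j, 0 <= (f * g) j.
Proof. by move=> f0 g0 j; rewrite fpsM sumr_ge0// => i _; rewrite mulr_ge0. Qed.

Lemma fpsXn_ge0 f n : (forall j, 0 <= f j) -> forall j, 0 <= (f ^+ n) j.
Proof.
move=> f0; elim: n => [|n IH] j; first by rewrite expr0 fps1 ler0n.
by rewrite exprS; exact: fpsM_ge0.
Qed.

End l1_norm.

(** * Smoothness of geometric and Poisson laws *)

Section smoothness.
Context (R : realType).
Implicit Types (f g h : fps R) (mu kappa s : R).

(** Summation by parts; for nonnegative h the boundary term only helps an upper bound once n >=
    mu. *)
Lemma abel_sum_W h mu n :
  \sum_(j < n.+1) (j%:R - mu) * (fpsW * h) j =
  \sum_(j < n) h j - (n%:R - mu) * h n.
Proof.
elim: n => [|n IH]; first by rewrite big_ord1 big_ord0 fpsWM /=; ring.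
by rewrite big_ord_recr /= IH big_ord_recr /= fpsWM /= -natr1; ring.
Qed.

(* If [kappa * W h] is the first-moment deviation of [f], summation by parts
   bounds the second moment of [f] about [mu] by [kappa], and AM-GM then bounds
   its first absolute moment. *)
Lemma l1_leW_score f h mu kappa s :
  (forall j, 0 <= f j) -> (forall j, 0 <= h j) -> l1_le f 1 -> l1_le h 1 ->
  0 < s -> s ^+ 2 <= kappa ->
  (forall j, (j%:R - mu) * f j = kappa * (fpsW * h) j) ->
  l1_le (fpsW * h) s^-1.
Proof.
move=> f0 h0 f1 h1 s0 sk score.
have k0 : 0 < kappa by apply: lt_le_trans sk; rewrite exprn_gt0.
have sum1 (u : fps R) n : (forall j, 0 <= u j) -> l1_le u 1 -> \sum_(j < n) u j <= 1.
  move=> u0 u1; apply: le_trans (u1 n); apply: ler_sum => j _; exact: ler_norm.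
pose v n := \sum_(j < n) (j%:R - mu) ^+ 2 * f j.
have v_mono n p : (n <= p)%N -> v n <= v p.
  move=> le_np; rewrite /v -!(big_mkord xpredT (fun j => (j%:R - mu) ^+ 2 * f j)).
  rewrite (big_cat_nat (leq0n n) le_np)/= lerDl sumr_ge0// => i _.
  by rewrite mulr_ge0// sqr_ge0.
have v_le n : v n <= kappa.
  (* An index beyond both n and mu: passing to the longer sum makes the boundary term
     nonpositive. *)
  pose p := (n + Num.Def.truncn `|mu|)%N.+1.
  have mup : mu <= p%:R.
    apply: le_trans (ler_norm mu) _; apply: ltW.
    apply: lt_le_trans (truncnS_gt _) _.
    by rewrite ler_nat ltnS leq_addl.
  have np : (n <= p.+1)%N by rewrite /p -addnS -addnS leq_addr.
  apply: le_trans (v_mono _ _ np) _.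
  rewrite /v.
  under eq_bigr do rewrite expr2 -mulrA score mulrCA.
  rewrite -mulr_sumr abel_sum_W -[leRHS]mulr1 ler_pM2l// lerBlDr.
  apply: (le_trans (sum1 h p h0 h1)); rewrite lerDl mulr_ge0// subr_ge0//.
move=> n.
have Wh j : (fpsW * h) j = kappa^-1 * ((j%:R - mu) * f j).
  by rewrite score mulKf// gt_eqF.
have amgm (d : R) : `|d| <= (kappa / s + d ^+ 2 * s / kappa) / 2.
  have -> : (kappa / s + d ^+ 2 * s / kappa) / 2 =
     `|d| + (kappa - `|d| * s) ^+ 2 / (2 * kappa * s).
    rewrite -(real_normK (num_real d)); field; rewrite !gt_eqF//.
  by rewrite lerDl divr_ge0 ?sqr_ge0// !mulr_ge0 ?ltW.
apply: (@le_trans _ _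
  (\sum_(j < n) kappa^-1 * ((kappa / s + (j%:R - mu) ^+ 2 * s / kappa) / 2 * f j))).
  apply: ler_sum => j _; rewrite Wh normrM gtr0_norm ?invr_gt0//.
  by rewrite ler_wpM2l ?invr_ge0 ?(ltW k0)// normrM (ger0_norm (f0 j)) ler_wpM2r.
have -> : \sum_(j < n) kappa^-1 *
    ((kappa / s + (j%:R - mu) ^+ 2 * s / kappa) / 2 * f j) =
    s^-1 / 2 * \sum_(j < n) f j + s / kappa ^+ 2 / 2 * v n.
  rewrite /v !mulr_sumr -big_split; apply: eq_bigr => j _ /=.
  by field; rewrite !gt_eqF.
apply: (@le_trans _ _ (s^-1 / 2 * 1 + s / kappa ^+ 2 / 2 * kappa)).
  rewrite lerD// ler_wpM2l ?sum1 ?v_le//.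
    by rewrite divr_ge0 ?invr_ge0 ?ltW.
  by rewrite !divr_ge0 ?sqr_ge0 ?ltW.
have -> : s^-1 / 2 * 1 + s / kappa ^+ 2 / 2 * kappa = (s^-1 + s / kappa) / 2.
  by field; rewrite !gt_eqF.
have : s / kappa <= s^-1.
  by rewrite ler_pdivrMr// mulrC ler_pdivlMr// -expr2.
lra.
Qed.

End smoothness.

(** * Geometric laws and their powers *)

Section geometric.
Context (R : realType).
Implicit Types (x y s : R) (j n : nat).

(** The geometric law on the nonnegative integers with mean x, that is, with success probability
    1/(1 + x). *)
Definition geom_fps x : fps R := fun j => x ^+ j / (1 + x) ^+ j.+1.

Lemma geom_fps_ge0 x : 0 <= x -> forall j, 0 <= geom_fps x j.
Proof. by move=> x0 j; rewrite divr_ge0// exprn_ge0// addr_ge0. Qed.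

Lemma geom_fpsK x : 1 + x != 0 -> (1 - fps_const x * fpsW) * geom_fps x = 1.
Proof.
move=> x1; apply/funext => j; rewrite mulrBl mul1r -mulrA fpsB fps_constM.
rewrite fpsWM fps1 /geom_fps.
case: j => [|j] /=; first by rewrite expr0 expr1; field.
by rewrite !exprS; field; rewrite expf_eq0 negb_and x1 orbT.
Qed.

Lemma geom_fps_l1 x : 0 <= x -> l1_le (geom_fps x) 1.
Proof.
move=> x0 n; have x1 : 1 + x != 0 by rewrite gt_eqF// ltr_pwDl.
have -> : \sum_(j < n) `|geom_fps x j| = 1 - (x / (1 + x)) ^+ n.
  elim: n => [|n IH]; first by rewrite big_ord0 expr0 subrr.
  rewrite big_ord_recr /= IH ger0_norm ?geom_fps_ge0// /geom_fps.
  by rewrite !expr_div_n !exprS; field; rewrite expf_eq0 negb_and x1 orbT.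
by rewrite gerBl exprn_ge0// divr_ge0// addr_ge0.
Qed.

Lemma geom_fps0 : geom_fps 0 = 1.
Proof.
apply/funext => j; rewrite /geom_fps fps1 addr0 expr1n divr1 expr0n.
by case: eqP.
Qed.

(** Partial fractions: (1 - y w)/(1 - x w) = y/x + (1 - y/x)/(1 - x w). Thus [G_x] is [G_y] plus an
    independent variable that is 0 with probability y/x and otherwise distributed as [G_x]. *)
Lemma geom_fps_factor x y : 0 <= y -> y <= x -> 0 < x ->
  geom_fps x = geom_fps y *
    (fps_const (y / x) + fps_const (1 - y / x) * geom_fps x).
Proof.
move=> y0 yx x0.
have Kx : (1 - fps_const x * fpsW) * geom_fps x = 1.
  by rewrite geom_fpsK// gt_eqF// ltr_pwDl// ltW.
have Ky : (1 - fps_const y * fpsW) * geom_fps y = 1.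
  by rewrite geom_fpsK// gt_eqF// ltr_pwDl.
set G := geom_fps x in Kx *.
have -> : fps_const (y / x) + fps_const (1 - y / x) * G =
          (1 - fps_const y * fpsW) * G.
  rewrite -[fps_const (y / x)]mulr1 -{1}Kx rmorphB rmorph1.
  have -> : fps_const y = fps_const (y / x) * fps_const x.
    by rewrite -rmorphM divfK// gt_eqF.
  ring.
by rewrite mulrA [_ * (1 - _)]mulrC Ky mul1r.
Qed.

(** Replaces distinct geometric factors by a power of a single one, to which the score estimate
    applies; the cofactor Q is a product of the mixtures above. *)
Lemma geom_fps_prod_factor y (s : seq R) : 0 < y -> (forall x, x \in s -> y <= x) ->
  exists2 Q : fps R, l1_le Q 1 & \prod_(x <- s) geom_fps x = geom_fps y ^+ size s * Q.
Proof.
move=> y0; elim: s => [|x s IH] ys.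
  by exists 1; rewrite ?big_nil ?expr0 ?mulr1//; exact: l1_le1.
have [t ts|Q Q1 EQ] := IH; first by apply: ys; rewrite in_cons ts orbT.
have yx : y <= x by apply: ys; rewrite mem_head.
have x0 : 0 < x by exact: lt_le_trans yx.
rewrite big_cons EQ (geom_fps_factor (ltW y0) yx x0).
set P := fps_const _ + _; exists (P * Q); last by rewrite exprS; ring.
rewrite -[1]mulr1; apply: l1_leM Q1.
have -> : 1 = `|y / x| + `|1 - y / x| * 1.
  rewrite mulr1 !ger0_norm ?subrKC//.
    by rewrite subr_ge0 ler_pdivrMr// mul1r.
  by rewrite divr_ge0 ?ltW.
apply: l1_leD (l1_le_const _) _; apply: l1_le_constM; apply: geom_fps_l1.
exact: ltW.
Qed.

(** The operator z d/dz: weighting by the index is a derivation, which is how the score identities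
    are obtained. *)
Definition fps_euler (f : fps R) : fps R := fun j => j%:R * f j.

Lemma fps_eulerM f g : fps_euler (f * g) = fps_euler f * g + f * fps_euler g.
Proof.
apply/funext => j; rewrite fpsD /fps_euler !fpsM mulr_sumr -big_split /=.
apply: eq_bigr => -[i /= lt_ij] _.
rewrite -{1}(subnKC (_ : (i <= j)%N))// natrD; ring.
Qed.

(** Apply the derivation to (1 - x w) G = 1 and multiply by G. *)
Lemma fps_euler_geom x : 1 + x != 0 ->
  fps_euler (geom_fps x) = fps_const x * fpsX * geom_fps x ^+ 2.
Proof.
move=> x1; have K := geom_fpsK x1; set G := geom_fps x in K *.
have e1 : fps_euler (1 : fps R) = 0.
  by apply/funext => -[|j]; rewrite /fps_euler fps1 fps0 ?mul0r ?mulr0.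
have ec : fps_euler (1 - fps_const x * fpsW) = - (fps_const x * fpsX).
  apply/funext => j.
  rewrite /fps_euler fpsB fpsN -[fpsW]mulr1 !fps_constM fpsWM !fps1 -[fpsX]mulr1.
  rewrite fpsXM.
  by case: j => [|[|j]]; rewrite /= ?fps1/=; ring.
have := fps_eulerM (1 - fps_const x * fpsW) G; rewrite K e1 ec => E.
have -> : fps_euler G = G * ((1 - fps_const x * fpsW) * fps_euler G).
  by rewrite mulrA [G * _]mulrC K mul1r.
have -> : (1 - fps_const x * fpsW) * fps_euler G = fps_const x * fpsX * G.
  by apply/eqP; rewrite -subr_eq0 [X in _ == X]E mulNr addrC.
ring.
Qed.

Lemma fps_euler_geomX x n : 1 + x != 0 -> fps_euler (geom_fps x ^+ n) =
  fps_const (n%:R * x) * fpsX * geom_fps x ^+ n.+1.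
Proof.
move=> x1; elim: n => [|n IH].
  apply/funext => -[|j]; rewrite expr0 mul0r rmorph0 !mul0r fps0 /fps_euler fps1.
    by rewrite mul0r.
  by rewrite mulr0.
rewrite exprS fps_eulerM IH fps_euler_geom// -natr1 !rmorphM rmorphD rmorph1 !exprS.
ring.
Qed.

(** The score identity pairs f = G^n with h = G^(n+1); here mu = n x is the mean of the negative
    binomial law f and kappa = n x (1 + x) its variance. *)
Lemma l1_leW_geomX x s n : 0 < x -> 0 < s -> s ^+ 2 <= n%:R * x * (1 + x) ->
  l1_le (fpsW * geom_fps x ^+ n.+1) s^-1.
Proof.
move=> x0 s0 sn; have x1 : 1 + x != 0 by rewrite gt_eqF// ltr_pwDl// ltW.
have G0 : forall j, 0 <= geom_fps x j by apply: geom_fps_ge0; exact: ltW.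
have G1 : l1_le (geom_fps x) 1 by apply: geom_fps_l1; exact: ltW.
apply: (@l1_leW_score _ (geom_fps x ^+ n) _ (n%:R * x) _ s _ _ _ _ s0 sn).
- exact: fpsXn_ge0.
- exact: fpsXn_ge0.
- exact: l1_leXn.
- exact: l1_leXn.
- move=> j; rewrite mulrBl -[j%:R * _]/(fps_euler _ j) -!fps_constM -fpsB.
  suff -> : fps_euler (geom_fps x ^+ n) - fps_const (n%:R * x) * geom_fps x ^+ n =
      fps_const (n%:R * x * (1 + x)) * (fpsW * geom_fps x ^+ n.+1) by [].
  (* Multiplying the second term by (1 - x w) G = 1 puts both terms over G^(n+1); then z - (1 - x w)
     = (1 + x) w. *)
  rewrite fps_euler_geomX// -[X in _ - _ * X]mul1r -(geom_fpsK x1).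
  rewrite !rmorphM rmorphD rmorph1 !exprS /fpsW.
  ring.
Qed.

End geometric.

(** * Poisson laws *)

Section poisson_fps.
Context (R : realType).
Implicit Types (a b s : R) (j n : nat).

Definition poisson_fps a : fps R := fun j => a ^+ j / j`!%:R * expR (- a).

Lemma poisson_fps_ge0 a : 0 <= a -> forall j, 0 <= poisson_fps a j.
Proof. by move=> a0 j; rewrite mulr_ge0 ?expR_ge0// divr_ge0// exprn_ge0. Qed.

Lemma sum_exp_coeff_le a n : 0 <= a ->
  \sum_(j < n) a ^+ j / j`!%:R <= expR a.
Proof.
move=> a0; have -> : \sum_(j < n) a ^+ j / j`!%:R = series (exp_coeff a) n.
  by rewrite /series /= big_mkord; apply: eq_bigr.
apply: nondecreasing_cvgn_le; last exact: is_cvg_series_exp_coeff.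
apply/nondecreasing_seqP => k; rewrite /series /= big_nat_recr//= lerDl.
by rewrite /exp_coeff /= divr_ge0// exprn_ge0.
Qed.

Lemma poisson_fps_l1 a : 0 <= a -> l1_le (poisson_fps a) 1.
Proof.
move=> a0 n; under eq_bigr do rewrite ger0_norm ?poisson_fps_ge0//.
rewrite -mulr_suml -[leRHS](@expRxMexpNx_1 _ a) ler_wpM2r ?expR_ge0//.
exact: sum_exp_coeff_le.
Qed.

(** Covers negative a, where the sequence is signed; the interpolation contains the factor exp(-(1 -
    t^2) a w). *)
Lemma poisson_fps_l1_gen a : l1_le (poisson_fps a) (expR (2 * `|a|)).
Proof.
move=> n.
have -> : \sum_(j < n) `|poisson_fps a j| =
    (\sum_(j < n) `|a| ^+ j / j`!%:R) * expR (- a).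
  rewrite mulr_suml; apply: eq_bigr => j _.
  by rewrite /poisson_fps !normrM normrX normfV normr_nat (gtr0_norm (expR_gt0 _)).
apply: (@le_trans _ _ (expR `|a| * expR (- a))).
  by rewrite ler_wpM2r ?expR_ge0 ?sum_exp_coeff_le.
by rewrite -expRD ler_expR mulr_natl mulr2n lerD2l -normrN ler_norm.
Qed.

Lemma poisson_fps0 : poisson_fps 0 = 1.
Proof.
apply/funext => -[|j]; rewrite /poisson_fps fps1 oppr0 expR0 mulr1 expr0n//=.
- by rewrite divr1.
- by rewrite mul0r.
Qed.

Lemma poisson_fpsD a b : poisson_fps (a + b) = poisson_fps a * poisson_fps b.
Proof.
apply/funext => j; rewrite fpsM /poisson_fps opprD expRD addrC exprDn.
rewrite !mulr_suml; apply: eq_bigr => -[i /= lt_ij] _.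
have le_ij : (i <= j)%N by [].
have := bin_fact le_ij => /(congr1 (fun k : nat => k%:R : R)).
rewrite -[_ *+ 'C(j, i)]mulr_natr !natrM => E.
have ni : i`!%:R != 0 :> R by rewrite pnatr_eq0 -lt0n fact_gt0.
have nji : (j - i)`!%:R != 0 :> R by rewrite pnatr_eq0 -lt0n fact_gt0.
have nj : j`!%:R != 0 :> R by rewrite pnatr_eq0 -lt0n fact_gt0.
have -> : 'C(j, i)%:R = j`!%:R / (i`!%:R * (j - i)`!%:R) :> R.
  by rewrite -E; field; rewrite ni nji.
by field; rewrite ni nji nj.
Qed.

Lemma poisson_fpsS a j : j.+1%:R * poisson_fps a j.+1 = a * poisson_fps a j.
Proof.
rewrite /poisson_fps exprS factS natrM; field.
by rewrite ?nat1r !pnatr_eq0 -lt0n fact_gt0.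
Qed.

(** The Poisson law is its own partner in the score identity: f = h and mu = kappa = a. *)
Lemma l1_leW_poisson a s : 0 <= a -> 0 < s -> s ^+ 2 <= a ->
  l1_le (fpsW * poisson_fps a) s^-1.
Proof.
move=> a0 s0 sa.
apply: (@l1_leW_score _ (poisson_fps a) _ a a s _ _ _ _ s0 sa).
- exact: poisson_fps_ge0.
- exact: poisson_fps_ge0.
- exact: poisson_fps_l1.
- exact: poisson_fps_l1.
- move=> -[|j]; rewrite fpsWM; first by ring.
  by rewrite mulrBl poisson_fpsS -mulrBr.
Qed.

End poisson_fps.

Section dilation.
Context (R : realType).
Implicit Types f g : fps R.

(** The substitution of z^2 for z, which turns the law of Z into that of 2 Z. *)
Definition fps_dilate2 f : fps R := fun j => if odd j then 0 else f j./2.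

Lemma fps_dilate2_1 : fps_dilate2 1 = 1.
Proof.
apply/funext => -[|[|j]]; rewrite /fps_dilate2 ?fps1//=.
by case: ifP => // _; rewrite fps1.
Qed.

Lemma fps_dilate2_l1 f B : l1_le f B -> l1_le (fps_dilate2 f) B.
Proof.
move=> fB n.
have double m : \sum_(j < m.*2) `|fps_dilate2 f j| = \sum_(j < m) `|f j|.
  elim: m => [|m IH]; first by rewrite !big_ord0.
  rewrite doubleS !big_ord_recr /= IH /fps_dilate2 /= odd_double /= doubleK.
  by rewrite normr0 addr0.
apply: le_trans (fB n); rewrite -double -addnn big_split_ord /= lerDl.
exact: sumr_ge0.
Qed.

Lemma fps_dilate2W f : fps_dilate2 (fpsW * f) = (fpsX ^+ 2 - 1) * fps_dilate2 f.
Proof.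
apply/funext => j; rewrite [in RHS]mulrBl mul1r fpsB expr2 -mulrA !fpsXM.
rewrite /fps_dilate2 fpsWM; case: j => [|[|j]] //=; rewrite ?subr0 fpsXM// negbK.
by case: ifP; rewrite ?subr0.
Qed.

End dilation.

(** * Coefficientwise derivatives *)

Section coefficientwise_derivative.
Context (R : realType).
Implicit Types (F G : R -> fps R) (t x : R).

Lemma is_derive_mul (f g : R -> R) t df dg :
  is_derive t 1 f df -> is_derive t 1 g dg ->
  is_derive t 1 (fun u => f u * g u) (df * g t + f t * dg).
Proof.
move=> dF dG; apply: (is_derive_eq (is_deriveM dF dG)).
by rewrite /GRing.scale /= addrC [g t * _]mulrC.
Qed.

Lemma is_derive_pow (f : R -> R) t df n : is_derive t 1 f df ->
  is_derive t 1 (fun u => f u ^+ n) (n%:R * f t ^+ n.-1 * df).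
Proof.
move=> dF; have := is_deriveX n dF.
rewrite (_ : (f ^+ n)%R = (fun u => f u ^+ n)); first exact.
by apply/funext => u; rewrite fctE.
Qed.

Lemma is_derive_line (a b t : R) : is_derive t 1 (fun u => a + u * b) b.
Proof.
rewrite (_ : (fun u => _) = cst a + (@id R) * cst b); last by [].
apply: is_derive_eq.
by rewrite scaler0 !add0r /GRing.scale /= mulr1.
Qed.

(** Coefficients are differentiated one at a time; the norm enters only through
    [l1_le_mean_value]. *)
Definition is_dfps F t (D : fps R) :=
  forall j, is_derive t 1 (fun u => F u j) (D j).

Lemma is_dfps_eq F t D D' : is_dfps F t D -> D = D' -> is_dfps F t D'.
Proof. by move=> + <-. Qed.

Lemma is_derive_big_sum (I : Type) (s : seq I) (h : I -> R -> R) (dh : I -> R) t :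
  (forall i, is_derive t 1 (h i) (dh i)) ->
  is_derive t 1 (fun u => \sum_(i <- s) h i u) (\sum_(i <- s) dh i).
Proof.
move=> hD; elim: s => [|i s IH].
  rewrite big_nil (_ : (fun u => _) = cst 0); first exact: is_derive_cst.
  by apply/funext => u; rewrite big_nil.
rewrite big_cons (_ : (fun u => _) = h i + (fun u => \sum_(i <- s) h i u)).
  exact: is_deriveD.
by apply/funext => u; rewrite big_cons.
Qed.

Lemma is_dfps_const (c : fps R) t : is_dfps (fun=> c) t 0.
Proof. by move=> j; exact: is_derive_cst. Qed.

Lemma is_dfpsM F G t DF DG : is_dfps F t DF -> is_dfps G t DG ->
  is_dfps (fun u => F u * G u) t (DF * G t + F t * DG).
Proof.
move=> dF dG j; rewrite fpsD !fpsM -big_split /=.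
apply: is_derive_big_sum => i.
have -> : DF i * G t (j - i)%N + F t i * DG (j - i)%N =
    F t i *: DG (j - i)%N + G t (j - i)%N *: DF i.
  by rewrite /GRing.scale /= addrC [_ * DF i]mulrC.
exact: (is_deriveM (dF i) (dG _)).
Qed.

Lemma is_dfpsX F t D n : is_dfps F t D ->
  is_dfps (fun u => F u ^+ n) t (n%:R * D * F t ^+ n.-1).
Proof.
move=> dF; elim: n => [|n IH].
  rewrite mul0r mul0r (_ : (fun u => _) = fun=> 1); first exact: is_dfps_const.
  by apply/funext => u; rewrite expr0.
rewrite (_ : (fun u => _) = fun u => F u * F u ^+ n); last first.
  by apply/funext => u; rewrite exprS.
apply: (is_dfps_eq (is_dfpsM dF IH)).
case: n {IH} => [|n] /=; first by ring.
by rewrite -[in RHS]natr1 exprS; ring.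
Qed.

Lemma is_dfps_prod_seq (I : eqType) (s : seq I) (F : I -> R -> fps R) t (L : I -> fps R) :
  (forall i, i \in s -> is_dfps (F i) t (F i t * L i)) ->
  is_dfps (fun u => \prod_(i <- s) F i u) t
    ((\prod_(i <- s) F i t) * \sum_(i <- s) L i).
Proof.
elim: s => [|i s IH] dF.
  rewrite !big_nil mulr0 (_ : (fun u => _) = fun=> 1); first exact: is_dfps_const.
  by apply/funext => u; rewrite big_nil.
rewrite !big_cons (_ : (fun u => _) = fun u => F i u * \prod_(i <- s) F i u).
  have dFi := dF i (mem_head _ _).
  have {}IH := IH (fun k ks => dF k (mem_behead (s := i :: s) ks)).
  by apply: (is_dfps_eq (is_dfpsM dFi IH)); ring.
by apply/funext => u; rewrite big_cons.
Qed.

Lemma is_dfps_line t : is_dfps (fun u => 1 + fps_const u * fpsW) t fpsW.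
Proof.
move=> j.
rewrite (_ : (fun u => _) = fun u => (1 : fps R) j + u * fpsW j).
  exact: is_derive_line.
by apply/funext => u /=; rewrite fpsD fps_constM.
Qed.

Lemma is_dfps_geom t x : 1 + t * x != 0 ->
  is_dfps (fun u => geom_fps (u * x)) t
    (geom_fps (t * x) * (fps_const x * fpsW * geom_fps (t * x))).
Proof.
move=> x1.
(* The quotient rule for one coefficient. At j = 0 the truncated exponent [j.-1] is harmless because
   of the factor j. *)
pose D : fps R := fun j => j%:R * x * (t * x) ^+ j.-1 / (1 + t * x) ^+ j.+1 -
  j.+1%:R * x * (t * x) ^+ j / (1 + t * x) ^+ j.+2.
have DE : (1 - fps_const (t * x) * fpsW) * D = fps_const x * fpsW * geom_fps (t * x).
  apply/funext => j; rewrite mulrBl mul1r -!mulrA fpsB !fps_constM !fpsWM.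
  rewrite /D /geom_fps; case: j => [|[|j]] /=; rewrite ?exprS ?expr0; field => //.
  by rewrite expf_eq0 negb_and x1 orbT.
have DP : is_dfps (fun u => geom_fps (u * x)) t D.
  move=> j.
  have dX : is_derive t 1 (fun u => u * x) x.
    rewrite (_ : (fun u => _) = fun u => 0 + u * x); first exact: is_derive_line.
    by apply/funext => u; rewrite add0r.
  have dV := @is_deriveV R (fun u => 1 + u * x) t x 1 x1 (is_derive_line 1 x t).
  have := is_derive_mul (is_derive_pow j dX) (is_derive_pow j.+1 dV).
  rewrite (_ : (fun u => _) = fun u => geom_fps (u * x) j); last first.
    by apply/funext => u; rewrite exprVn.
  move=> /is_derive_eq; apply.
  rewrite /D /GRing.scale /= !exprVn !exprS; field => //.
  by rewrite expf_eq0 negb_and x1 orbT.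
apply: (is_dfps_eq DP).
by rewrite -DE mulrA [geom_fps _ * _]mulrC geom_fpsK// mul1r.
Qed.

Lemma is_dfps_poisson (a : R -> R) t da : is_derive t 1 a da ->
  is_dfps (fun u => poisson_fps (a u)) t
    (poisson_fps (a t) * (fps_const da * fpsW)).
Proof.
move=> dA j; rewrite mulrCA fps_constM -[_ * fpsW]mulrC fpsWM.
have dN : is_derive t 1 (fun u => - a u) (- da) by exact: is_deriveN.
have dE := @is_derive1_comp _ expR (fun u => - a u) t _ _ (is_derive_expR _) dN.
have := is_derive_mul (is_derive_mul (is_derive_pow j dA)
   (is_derive_cst (j`!%:R^-1 : R^o) t 1)) dE.
move=> /is_derive_eq; apply.
have n0 k : k`!%:R != 0 :> R by rewrite pnatr_eq0 -lt0n fact_gt0.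
rewrite /poisson_fps /= /cst; case: j => [|j] /=; first by rewrite fact0; field.
by rewrite factS natrM exprS; field; rewrite n0 nat1r pnatr_eq0.
Qed.

Lemma is_dfps_dilate2 F t D : is_dfps F t D ->
  is_dfps (fun u => fps_dilate2 (F u)) t (fps_dilate2 D).
Proof.
move=> dF j; rewrite /fps_dilate2; case: ifP => _; last exact: dF.
exact: is_derive_cst.
Qed.

(** Pairing with the signs of the increment F 1 - F 0 turns its norm into the increment of a scalar
    function, to which the mean value theorem applies. *)
Lemma l1_le_mean_value F (D : R -> fps R) B :
  (forall t, 0 <= t <= 1 -> is_dfps F t (D t)) ->
  (forall t, 0 <= t <= 1 -> l1_le (D t) B) ->
  l1_le (F 1 - F 0) B.
Proof.
move=> dF DB n.
pose e j := Num.sg ((F 1 - F 0) j).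
pose phi u := \sum_(j < n) e j * F u j.
pose dphi u := \sum_(j < n) e j * D u j.
have dphiP t : 0 <= t <= 1 -> is_derive t 1 phi (dphi t).
  move=> t01; apply: is_derive_big_sum => j.
  exact: is_deriveZ (dF _ t01 j).
have [||c c01] := @MVT R phi dphi 0 1 ltr01.
- by move=> t; rewrite in_itv /= => /andP[/ltW t0 /ltW t1]; apply: dphiP; rewrite t0.
- apply: derivable_within_continuous => t; rewrite in_itv /= => t01.
  by have [] := dphiP _ t01.
have -> : phi 1 - phi 0 = \sum_(j < n) `|(F 1 - F 0) j|.
  rewrite -sumrB; apply: eq_bigr => j _.
  by rewrite -mulrBr -fpsB normrEsg.
move=> ->; rewrite subr0 mulr1; apply: le_trans (ler_norm _) _.
have /DB : 0 <= c <= 1.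
  by move: c01; rewrite in_itv /= => /andP[/ltW -> /ltW ->].
move=> /(_ n); apply: le_trans.
apply: (le_trans (ler_norm_sum _ _ _)); apply: ler_sum => j _.
rewrite normrM ler_piMl// /e normr_sg; by case: eqP.
Qed.

End coefficientwise_derivative.

(** * The interpolation *)

Section interpolation.
Context (R : realType).
Variables (s : seq R) (f : nat) (a : R).

Let M := \sum_(x <- s) x.

(** All factors of the interpolation except (1 + t w)^f. Since z^2 - 1 = w^2 + 2 w, the dilated
    Poisson factor brings an extra linear term (1 - t^2) a w, which the other Poisson parameter
    subtracts. *)
Definition smooth_part (t : R) : fps R :=
  (\prod_(x <- s) geom_fps (t * x)) *
  poisson_fps ((1 - t) * (M + f%:R) - (1 - t ^+ 2) * a) *
  fps_dilate2 (poisson_fps ((1 - t ^+ 2) * (a / 2))).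

Definition interp (t : R) : fps R :=
  (1 + fps_const t * fpsW) ^+ f * smooth_part t.

Lemma interp0 : interp 0 =
  poisson_fps (M + f%:R - a) * fps_dilate2 (poisson_fps (a / 2)).
Proof.
rewrite /interp /smooth_part rmorph0 mul0r addr0 expr1n mul1r.
rewrite big1 ?mul1r; last by move=> x _; rewrite mul0r geom_fps0.
by rewrite subr0 expr0n /= subr0 !mul1r.
Qed.

Lemma interp1 : interp 1 = fpsX ^+ f * \prod_(x <- s) geom_fps x.
Proof.
rewrite /interp /smooth_part rmorph1 mul1r /fpsW subrKC; congr (_ * _).
rewrite expr1n !subrr !mul0r subrr !poisson_fps0 fps_dilate2_1 !mulr1.
by apply: eq_bigr => x _; rewrite mul1r.
Qed.

Hypothesis s_ge0 : forall x, x \in s -> 0 <= x.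
Hypothesis aE : a = \sum_(x <- s) x ^+ 2 - f%:R.

(** What is left of x w/(1 - t x w) and f w/(1 + t w) beyond second order in w: t^2 w^3 times x^3/(1
    - t x w) and f/(1 + t w). *)
Definition interp_deriv (t : R) : fps R :=
  fps_const (t ^+ 2) * (fpsW ^+ 3 * smooth_part t) *
  ((1 + fps_const t * fpsW) ^+ f *
     (\sum_(x <- s) fps_const (x ^+ 3) * geom_fps (t * x)) +
   fps_const f%:R * (1 + fps_const t * fpsW) ^+ f.-1).

(* The linear and quadratic terms of the logarithmic derivative cancel by the
   choice of the means and of [a]. *)
Lemma is_dfps_interp t : 0 <= t -> is_dfps interp t (interp_deriv t).
Proof.
move=> t0.
have tx0 x : x \in s -> 1 + t * x != 0.
  by move=> /s_ge0 x0; rewrite gt_eqF// ltr_pwDl// mulr_ge0.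
have dU := is_dfpsX f (is_dfps_line t).
have dG : is_dfps (fun u => \prod_(x <- s) geom_fps (u * x)) t
    ((\prod_(x <- s) geom_fps (t * x)) *
     \sum_(x <- s) fps_const x * fpsW * geom_fps (t * x)).
  apply: is_dfps_prod_seq => x xs; apply: is_dfps_geom; exact: tx0.
have dl : is_derive t 1 (fun u => (1 - u) * (M + f%:R) - (1 - u ^+ 2) * a)
   (- (M + f%:R) + 2 * t * a).
  have := is_derive_mul (is_derive_line 0 1 t) (is_derive_line (- (M + f%:R)) a t).
  have -> : (1 * (- (M + f%:R) + t * a) + (0 + t * 1) * a) =
    (- (M + f%:R) + 2 * t * a) by ring.
  move=> /(is_deriveD (is_derive_cst (M + f%:R - a : R^o) t 1)).
  rewrite add0r.
  rewrite (_ : (_ + _)%R = (fun u => (1 - u) * (M + f%:R) - (1 - u ^+ 2) * a)) //.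
  by apply/funext => u; rewrite fctE /cst; ring.
have dq : is_derive t 1 (fun u => (1 - u ^+ 2) * (a / 2)) (- t * a).
  have := is_derive_mul (is_derive_line 0 1 t) (is_derive_line 0 (- (a / 2)) t).
  have -> : (1 * (0 + t * - (a / 2)) + (0 + t * 1) * (- (a / 2))) = - t * a.
    by field.
  move=> /(is_deriveD (is_derive_cst (a / 2 : R^o) t 1)).
  rewrite add0r.
  rewrite (_ : (_ + _)%R = (fun u => (1 - u ^+ 2) * (a / 2)))//.
  by apply/funext => u; rewrite fctE /cst; ring.
have dP := is_dfps_poisson dl.
have dD := is_dfps_dilate2 (is_dfps_poisson dq).
have := is_dfpsM dU (is_dfpsM (is_dfpsM dG dP) dD).
move=> /is_dfps_eq; apply.
rewrite /interp_deriv /smooth_part.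
set G := \prod_(x <- s) _.
set P := poisson_fps _.
set Q := poisson_fps _.
set U := 1 + _ * _.
have -> : fps_dilate2 (Q * (fps_const (- t * a) * fpsW)) =
   fps_const (- t * a) * ((fpsX ^+ 2 - 1) * fps_dilate2 Q).
  rewrite -fps_dilate2W; apply/funext => j.
  rewrite fps_constM /fps_dilate2; case: ifP => _; first by rewrite mulr0.
  by rewrite mulrCA fps_constM [Q * _]mulrC.
set D := fps_dilate2 Q.
have X2 : fpsX ^+ 2 - 1 = fpsW ^+ 2 + 2 * fpsW :> fps R by rewrite /fpsW; ring.
rewrite X2.
(* Geometric expansion to third order, by two uses of g = 1 + t x w g; the hypothesis on a rewrites
   the sum of squares as a + f. *)
have sumE : \sum_(x <- s) fps_const x * fpsW * geom_fps (t * x) =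
    fps_const (t ^+ 2) * fpsW ^+ 3 *
      (\sum_(x <- s) fps_const (x ^+ 3) * geom_fps (t * x)) +
    fps_const M * fpsW + fps_const (t * (a + f%:R)) * fpsW ^+ 2.
  rewrite aE subrK /M mulr_sumr (rmorph_sum (@fps_const R)) /=.
  rewrite (mulr_sumr _ _ _ t) (rmorph_sum (@fps_const R)) /= !mulr_suml.
  rewrite -!big_split /=; rewrite !big_seq; apply: eq_bigr => x xs.
  have K := geom_fpsK (tx0 _ xs).
  move: K; set g := geom_fps _ => K.
  have gE : g = 1 + fps_const (t * x) * fpsW * g by rewrite -{1}K; ring.
  rewrite rmorphM /= in gE; rewrite !rmorphXn !rmorphM /=.
  set cx := fps_const x in gE *; set ct := fps_const t in gE *.
  rewrite {1}gE {1}gE; ring.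
rewrite sumE.
(* For f = 0 the exponent [f.-1] is also 0, but both sides vanish. *)
have US : fps_const f%:R * U ^+ f = fps_const f%:R * U ^+ f.-1 * U.
  by case: (f) => [|n]; rewrite ?rmorph0 ?mul0r//= exprS; ring.
rewrite -[f%:R in LHS](rmorph_nat (@fps_const R)).
move: (\sum_(x <- s) _) => S.
rewrite !rmorphXn !rmorphD !rmorphN !rmorphM /=.
set cf := fps_const f%:R in US *; set ct := fps_const t in US *.
set ca := fps_const a; set cM := fps_const M.
(* The bracket collapses to t^2 w^3 S; the outer terms combine through (1 + t w)(t w^2 - w) = t^2
   w^3 - w. *)
transitivity (cf * U ^+ f.-1 * fpsW * (G * P * D) +
   U ^+ f * (G * P * D) * (ct ^+ 2 * fpsW ^+ 3 * S + ct * ca * fpsW ^+ 2 +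
       2 * ct * ca * fpsW - ct * ca * (fpsW ^+ 2 + 2 * fpsW)) +
   cf * U ^+ f * (ct * fpsW ^+ 2 - fpsW) * (G * P * D)).
  by ring.
rewrite US /U; ring.
Qed.

Lemma interp_l1_le K : (forall t, 0 <= t <= 1 -> l1_le (fpsW ^+ 3 * smooth_part t) K) ->
  l1_le (interp 1 - interp 0) ((\sum_(x <- s) x ^+ 3 + f%:R) * K).
Proof.
move=> WK; apply: (l1_le_mean_value (D := interp_deriv)).
  by move=> t /andP[t0 _]; exact: is_dfps_interp.
move=> t t01; have /andP[t0 t1] := t01; rewrite mulrC.
have K0 := l1_le_ge0 (WK _ t01).
apply: l1_leM.
  apply: (@l1_le_trans _ _ (`|t ^+ 2| * K)); last exact/l1_le_constM/WK.
  by rewrite ler_piMl// ger0_norm ?sqr_ge0// expr_le1.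
(* 1 + t w = (1 - t) + t z is a Bernoulli law. *)
have U1 : l1_le (1 + fps_const t * fpsW) 1.
  have -> : 1 + fps_const t * fpsW = fps_const (1 - t) + fps_const t * fpsX.
    by rewrite rmorphB rmorph1 /fpsW; ring.
  rewrite -[X in l1_le _ X](subrK t); apply: l1_leD.
    by rewrite -[X in l1_le _ X]ger0_norm ?subr_ge0//; exact: l1_le_const.
  rewrite -[X in l1_le _ X]mulr1 -[X in l1_le _ (X * _)]ger0_norm//.
  exact/l1_le_constM/l1_leX.
apply: l1_leD; last first.
  rewrite -[X in l1_le _ X]mulr1; apply: l1_leM; last exact: l1_leXn.
  by rewrite -[X in l1_le _ X]ger0_norm//; exact: l1_le_const.
rewrite -[X in l1_le _ X]mul1r; apply: l1_leM; first exact: l1_leXn.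
rewrite !big_seq; apply: l1_le_sum_seq => x xs; have x0 := s_ge0 xs.
rewrite -[X in l1_le _ X]mulr1 -[X in l1_le _ (X * _)]ger0_norm ?exprn_ge0//.
by apply/l1_le_constM/geom_fps_l1; rewrite mulr_ge0.
Qed.

End interpolation.

(** * Third-order smoothness along the interpolation *)

Section smooth_part_bound.
Context (R : realType).
Variables (s : seq R) (f : nat) (a r : R).
Hypothesis s_ge0 : forall x, x \in s -> 0 <= x.
Hypothesis a01 : 0 <= a <= 1.
Hypothesis r_gt0 : 0 < r.

Let M := \sum_(x <- s) x.

Let M_ge0 : 0 <= M.
Proof. by rewrite /M big_seq sumr_ge0. Qed.

Lemma l1_le_prod_geom (u : seq R) : (forall x, x \in u -> 0 <= x) ->
  l1_le (\prod_(x <- u) geom_fps x) 1.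
Proof.
move=> u0; rewrite big_seq; elim/big_ind : _ => [|g h g1 h1|x xu].
- exact: l1_le1.
- by rewrite -[1]mulr1; exact: l1_leM.
- exact/geom_fps_l1/u0.
Qed.

(** The factors depending on a need not form a probability law, but a <= 1 bounds their norm by a
    constant. *)
Lemma l1_le_correction t : 0 <= t <= 1 ->
  l1_le (poisson_fps (- ((1 - t ^+ 2) * a)) *
         fps_dilate2 (poisson_fps ((1 - t ^+ 2) * (a / 2)))) (expR 2).
Proof.
move=> /andP[t0 t1]; have /andP[a0 a1] := a01.
have t2 : 0 <= 1 - t ^+ 2 <= 1 by rewrite subr_ge0 expr_le1// t1 gerBl sqr_ge0.
have /andP[t20 t21] := t2.
rewrite -[X in l1_le _ X]mulr1; apply: l1_leM.
  apply: (l1_le_trans _ (poisson_fps_l1_gen _)).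
  rewrite ler_expR -[leRHS]mulr1 ler_wpM2l// normrN ger0_norm ?mulr_ge0//.
  by rewrite mulr_ile1.
by apply/fps_dilate2_l1/poisson_fps_l1; rewrite mulr_ge0// divr_ge0.
Qed.

Lemma l1_leW3_smooth_part t : 0 <= t <= 1 ->
  l1_le (fpsW ^+ 3 * ((\prod_(x <- s) geom_fps (t * x)) *
                      poisson_fps ((1 - t) * (M + f%:R)))) (r^-1 ^+ 3) ->
  l1_le (fpsW ^+ 3 * smooth_part s f a t) (expR 2 * r^-1 ^+ 3).
Proof.
move=> t01 H; rewrite mulrC /smooth_part poisson_fpsD.
have := l1_leM H (l1_le_correction t01).
by congr (l1_le _ _); ring.
Qed.

(** Serves the case of bounded variance: the norm 2 of w is at most 1/r. *)
Lemma l1_leW3_trivial t : r <= 2^-1 -> 0 <= t <= 1 ->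
  l1_le (fpsW ^+ 3 * smooth_part s f a t) (expR 2 * r^-1 ^+ 3).
Proof.
move=> r2 t01; apply: l1_leW3_smooth_part => //; have /andP[t0 t1] := t01.
have W3 : l1_le (fpsW ^+ 3 : fps R) (r^-1 ^+ 3).
  have W1 : l1_le (fpsW : fps R) r^-1.
    apply: l1_le_trans (@l1_leW R).
    by rewrite -[leLHS]invrK lef_pV2// posrE invr_gt0.
  by rewrite !exprS !expr0; do !apply: l1_leM => //; exact: l1_le1.
rewrite -[X in l1_le _ X]mulr1; apply: l1_leM => //.
rewrite -[X in l1_le _ X]mulr1; apply: l1_leM.
  have := @l1_le_prod_geom [seq t * x | x <- s].
  rewrite big_map; apply => _ /mapP[x xs ->]; rewrite mulr_ge0//; exact: s_ge0.
apply: poisson_fps_l1; rewrite mulr_ge0 ?subr_ge0// addr_ge0//.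
Qed.

(** The Poisson parameter is at least (M + f)/2; each of its three equal parts absorbs one factor w,
    whence the 6. *)
Lemma l1_leW3_half_left t : r ^+ 2 <= (M + f%:R) / 6 -> 0 <= t <= 2^-1 ->
  l1_le (fpsW ^+ 3 * smooth_part s f a t) (expR 2 * r^-1 ^+ 3).
Proof.
move=> r2 /andP[t0 t2]; have t1 : t <= 1 by lra.
have t01 : 0 <= t <= 1 by rewrite t0 t1.
apply: l1_leW3_smooth_part => //.
set l := (1 - t) * (M + f%:R).
have l0 : 0 <= l by rewrite mulr_ge0 ?subr_ge0// addr_ge0.
have rl : r ^+ 2 <= l / 3.
  apply: le_trans r2 _; rewrite /l.
  have : 0 <= M + f%:R by rewrite addr_ge0.
  move: (M + f%:R) => c c0; nra.
have -> : poisson_fps l = poisson_fps (l / 3) ^+ 3.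
  have {1}-> : l = l / 3 + (l / 3 + l / 3) by field.
  by rewrite !poisson_fpsD !exprS expr0 mulr1.
have Wp := @l1_leW_poisson R (l / 3) r (divr_ge0 l0 (ler0n _ 3)) r_gt0 rl.
set G := \prod_(x <- s) _.
have G1 : l1_le G 1.
  have := @l1_le_prod_geom [seq t * x | x <- s].
  rewrite big_map; apply => _ /mapP[x xs ->]; rewrite mulr_ge0//; exact: s_ge0.
have := l1_leM (l1_leM (l1_leM Wp Wp) Wp) G1.
by congr (l1_le _ _); ring.
Qed.

(** As t >= 1/2, the means t x with x in u are at least y, so [G_y] can be extracted 3 (N + 1)
    times; each block of N + 1 copies absorbs one factor w. *)
Lemma l1_leW3_half_right (u v : seq R) (N : nat) (y : R) t :
  s = u ++ v -> size u = (3 * N.+1)%N -> 0 < y ->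
  (forall x, x \in u -> 2 * y <= x) -> r ^+ 2 <= N%:R * y * (1 + y) ->
  2^-1 <= t <= 1 ->
  l1_le (fpsW ^+ 3 * smooth_part s f a t) (expR 2 * r^-1 ^+ 3).
Proof.
move=> sE su y0 yu rN /andP[t2 t1]; have t0 : 0 <= t by lra.
have t01 : 0 <= t <= 1 by rewrite t0 t1.
apply: l1_leW3_smooth_part => //.
have [Q Q1 EQ] : exists2 Q : fps R, l1_le Q 1 &
    \prod_(x <- u) geom_fps (t * x) = geom_fps y ^+ (3 * N.+1) * Q.
  have [|Q Q1] := @geom_fps_prod_factor R y [seq t * x | x <- u] y0.
    by move=> _ /mapP[x xu ->]; have := yu _ xu; nra.
  by rewrite big_map size_map su => EQ; exists Q.
have Wg := @l1_leW_geomX R y r N y0 r_gt0 rN.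
rewrite sE big_cat /= EQ.
have G1 : l1_le (\prod_(x <- v) geom_fps (t * x)) 1.
  have := @l1_le_prod_geom [seq t * x | x <- v].
  rewrite big_map; apply => _ /mapP[x xs ->]; rewrite mulr_ge0//; apply: s_ge0.
  by rewrite sE mem_cat xs orbT.
have P1 : l1_le (poisson_fps ((1 - t) * (M + f%:R))) 1.
  by apply: poisson_fps_l1; rewrite mulr_ge0 ?subr_ge0// addr_ge0.
have := l1_leM (l1_leM (l1_leM (l1_leM (l1_leM Wg Wg) Wg) Q1) G1) P1.
rewrite mulSn mulSn mul1n !exprD.
by congr (l1_le _ _); ring.
Qed.

End smooth_part_bound.

(** * Estimates for the coupon collector *)

Section coupon_excess.
Context (R : realType).
Implicit Types (n m k : nat).

(** The mean number of failures before the first success of probability k/n. *)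
Definition excess n k : R := n%:R / k%:R - 1.

Definition excesses n m := [seq excess n k | k <- index_iota m.+1 n.+1].

Lemma excess_ge0 n k : (0 < k)%N -> (k <= n)%N -> 0 <= excess n k.
Proof.
by move=> k0 kn; rewrite subr_ge0 ler_pdivlMr ?ltr0n// mul1r ler_nat.
Qed.

Lemma excesses_ge0 n m x : x \in excesses n m -> 0 <= x.
Proof.
move=> /mapP[k]; rewrite mem_index_iota ltnS => /andP[mk kn] ->.
by apply: excess_ge0 => //; exact: leq_ltn_trans mk.
Qed.

Lemma sum_excesses (h : R -> R) n m :
  \sum_(x <- excesses n m) h x = \sum_(m.+1 <= k < n.+1) h (excess n k).
Proof. by rewrite big_map. Qed.

Lemma sum_excesses_mean n m : (m <= n)%N ->
  \sum_(x <- excesses n m) x = coupon_mean R n m - (n%:R - m%:R).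
Proof.
move=> mn; rewrite (sum_excesses id) sumrB /coupon_mean mulr_sumr.
by rewrite sumr_const_nat subSS natrB.
Qed.

Lemma sum_excesses_var n m : coupon_variance R n m =
  \sum_(x <- excesses n m) x + \sum_(x <- excesses n m) x ^+ 2.
Proof.
rewrite (sum_excesses id) (sum_excesses (fun x => x ^+ 2)) -big_split /=.
rewrite /coupon_variance mulr_sumr !big_nat; apply: eq_bigr => k /andP[mk _].
rewrite /excess; field; rewrite pnatr_eq0 -lt0n; exact: leq_ltn_trans mk.
Qed.

(** Telescoping, as 1/(n + 1)^2 <= 1/n - 1/(n + 1). *)
Lemma sum_invr_sqr_le n m : (0 < m)%N -> (m <= n)%N ->
  \sum_(m.+1 <= k < n.+1) (k%:R ^+ 2)^-1 <= m%:R^-1 - n%:R^-1 :> R.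
Proof.
move=> m0; elim: n => [|n IH]; first by rewrite leqn0 => /eqP m00; rewrite m00 in m0.
rewrite leq_eqVlt => /predU1P[<-|]; first by rewrite big_geq// subrr.
rewrite ltnS => mn; rewrite big_nat_recr//=.
have n0 : 0 < n%:R :> R by rewrite ltr0n (leq_trans m0).
apply: (le_trans (lerD (IH mn) (lexx _))).
have -> : m%:R^-1 - n.+1%:R^-1 = m%:R^-1 - n%:R^-1 + (n%:R^-1 - n.+1%:R^-1) :> R.
  by rewrite addrA subrK.
rewrite lerD2l -subr_ge0.
have -> : n%:R^-1 - n.+1%:R^-1 - (n.+1%:R ^+ 2)^-1 = (n%:R * n.+1%:R ^+ 2)^-1 :> R.
  by rewrite -natr1; field; rewrite gt_eqF// gt_eqF// addr_gt0.
by rewrite invr_ge0 mulr_ge0// sqr_ge0.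
Qed.

Lemma coupon_variance_le n m : (0 < m)%N -> (m <= n)%N ->
  coupon_variance R n m <= (n%:R - m%:R) ^+ 2 / m%:R.
Proof.
move=> m0 mn.
have m0' : 0 < m%:R :> R by rewrite ltr0n.
have n0' : 0 < n%:R :> R by rewrite ltr0n (leq_trans m0).
apply: (@le_trans _ _ (n%:R * ((n%:R - m%:R) *
    \sum_(m.+1 <= k < n.+1) (k%:R ^+ 2)^-1))).
  rewrite ler_wpM2l// mulr_sumr !big_nat ler_sum// => k /andP[mk kn].
  by rewrite ler_wpM2r ?invr_ge0 ?sqr_ge0// lerB// ler_nat ltnW.
apply: (@le_trans _ _ (n%:R * ((n%:R - m%:R) * (m%:R^-1 - n%:R^-1)))).
  by rewrite !ler_wpM2l// ?subr_ge0 ?ler_nat// sum_invr_sqr_le.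
by rewrite le_eqVlt; apply/orP; left; apply/eqP; field; rewrite !gt_eqF.
Qed.

Lemma coupon_variance_gt0 n m : (0 < m)%N -> (m + 4 <= n)%N -> 0 < coupon_variance R n m.
Proof.
move=> m0 mn; apply: mulr_gt0; first by rewrite ltr0n; lia.
rewrite big_ltn; last by lia.
rewrite ltr_pwDl//.
  by rewrite divr_gt0 ?exprn_gt0 ?ltr0n// subr_gt0 ltr_nat; lia.
rewrite big_nat sumr_ge0// => k /andP[_ kn].
by rewrite divr_ge0 ?sqr_ge0// subr_ge0 ler_nat.
Qed.

(** Write x^3 = x^2/(1 + x) times (x + x^2). The first factor increases with x, and its value at X =
    n/m - 1 is (n - m)^2/(n m); the second sums to the variance. *)
Lemma sum_excesses_cube_le n m : (0 < m)%N -> (m < n)%N ->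
  \sum_(x <- excesses n m) x ^+ 3 <=
  (n%:R - m%:R) ^+ 2 / (n%:R * m%:R) * coupon_variance R n m.
Proof.
move=> m0 mn; rewrite sum_excesses_var -big_split mulr_sumr !big_seq /=.
apply: ler_sum => x; have m0' : 0 < m%:R :> R by rewrite ltr0n.
move=> xs; have x0 := excesses_ge0 xs; move: xs => /mapP[k].
rewrite mem_index_iota ltnS => /andP[mk kn] xE.
have k0 : 0 < k%:R :> R by rewrite ltr0n (leq_trans _ mk).
have n0' : 0 < n%:R :> R by rewrite ltr0n (leq_trans m0)// ltnW.
set X : R := (n%:R - m%:R) / m%:R.
have X0 : 0 <= X by rewrite divr_ge0 ?ler0n// subr_ge0 ler_nat ltnW.
have xX : x <= X.
  rewrite xE /excess /X mulrBl divff ?gt_eqF// lerD2r ler_pM2l//.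
  by rewrite lef_pV2 ?posrE// ler_nat ltnW.
have -> : (n%:R - m%:R) ^+ 2 / (n%:R * m%:R) = X ^+ 2 / (1 + X).
  by rewrite /X; field; rewrite !gt_eqF//= subrKC.
have -> : x ^+ 3 = x ^+ 2 / (1 + x) * (x + x ^+ 2).
  by field; rewrite gt_eqF// ltr_pwDl.
rewrite ler_wpM2r ?addr_ge0 ?sqr_ge0//.
rewrite ler_pdivrMr ?ltr_pwDl// mulrAC ler_pdivlMr ?ltr_pwDl//.
rewrite -subr_ge0.
have -> : X ^+ 2 * (1 + x) - x ^+ 2 * (1 + X) = (X - x) * (X + x + X * x) by ring.
by rewrite mulr_ge0 ?subr_ge0// !addr_ge0// mulr_ge0.
Qed.

(* When the sum of squares is below 1, every excess x is below 1, so x^2 <= x. *)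
Lemma sum_excesses_sqr_le n m : \sum_(x <- excesses n m) x ^+ 2 < 1 ->
  \sum_(x <- excesses n m) x ^+ 2 <= \sum_(x <- excesses n m) x.
Proof.
move=> S1; rewrite !big_seq; apply: ler_sum => x xs.
have x0 := excesses_ge0 xs.
suff x1 : x <= 1 by rewrite expr2 ler_piMl.
have : x ^+ 2 <= 1.
  apply: le_trans (ltW S1); rewrite (big_rem x)//= lerDl.
  by apply: sumr_ge0 => y _; exact: sqr_ge0.
by rewrite expr_le1.
Qed.

(** The excesses decrease along the list, so u takes the largest. N has the order of min(m, n - m),
    and the means in u stay above a third of (n - m)/m. *)
Lemma excesses_split n m :
  let N := ((m * (n - m)) %/ (12 * n))%N in
  let y := (n%:R - m%:R) / (6 * m%:R) : R in
  (24 <= m)%N -> (m + 4 <= n)%N -> (0 < N)%N ->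
  exists u v, [/\ excesses n m = u ++ v, size u = (3 * N.+1)%N,
    forall x, x \in u -> 2 * y <= x &
    coupon_variance R n m / 900 <= N%:R * y * (1 + y)].
Proof.
move=> N y m24 mn N0.
have n12 : (0 < 12 * n)%N by lia.
have Nle : (N * (12 * n) <= m * (n - m))%N by exact: leq_trunc_div.
have Nlt : (m * (n - m) < N.+1 * (12 * n))%N by exact: ltn_ceil.
(* N >= 1 gives 3 (N + 1) <= 6 N, so the offsets d = k - m of the factors in u are at most m (n -
   m)/(2 n). *)
have dle d : (d <= 3 * N.+1)%N -> (2 * (d * n) <= m * (n - m))%N.
  move=> dN; apply: leq_trans Nle; have d6 : (d <= 6 * N)%N by lia.
  have : (d * n <= 6 * N * n)%N by rewrite leq_mul.
  by lia.
have d3 : (m + 3 * N.+1 <= n)%N.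
  rewrite leqNgt; apply/negP => lt_n; have := dle _ (leqnn _).
  have : (m * (n - m) <= n * (3 * N.+1))%N by rewrite leq_mul//; lia.
  have : (0 < n * (3 * N.+1))%N by rewrite muln_gt0; lia.
  by rewrite [(n * _)%N]mulnC; move: (3 * N.+1 * n)%N (m * (n - m))%N => a b; lia.
have m0 : 0 < m%:R :> R by rewrite ltr0n; lia.
have n0 : 0 < n%:R :> R by rewrite ltr0n; lia.
exists [seq excess n k | k <- index_iota m.+1 (m + 3 * N.+1).+1].
exists [seq excess n k | k <- index_iota (m + 3 * N.+1).+1 n.+1]; split.
- rewrite -map_cat /excesses /index_iota; congr map.
  rewrite -[LHS](_ : iota m.+1 (3 * N.+1 + (n - (m + 3 * N.+1))) = _); last first.
    by congr iota; lia.
  by rewrite iotaD; congr (iota _ _ ++ iota _ _); lia.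
- by rewrite size_map size_iota; lia.
- move=> x /mapP[k]; rewrite mem_index_iota ltnS => /andP[mk kn] ->.
  have [d kE] : exists d, k = (m + d)%N by exists (k - m)%N; lia.
  have dn : (2 * (d * n) <= m * (n - m))%N by apply: dle; lia.
  have : (k * (n - m) <= 3 * (m * (n - k)))%N.
    have [e nE] : exists e, n = (m + d + e)%N by exists (n - k)%N; lia.
    move: dn; rewrite kE nE (_ : m + d + e - m = d + e)%N; last by lia.
    by rewrite (_ : m + d + e - (m + d) = e)%N; lia.
  have k0 : 0 < k%:R :> R by rewrite ltr0n; lia.
  rewrite -(ler_nat R) !natrM !natrB; [|lia|lia] => H.
  rewrite /y /excess.
  have -> : 2 * ((n%:R - m%:R) / (6 * m%:R)) = (n%:R - m%:R) / (3 * m%:R) :> R.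
    by field; rewrite gt_eqF.
  have -> : n%:R / k%:R - 1 = (n%:R - k%:R) / k%:R :> R by field; rewrite gt_eqF.
  rewrite ler_pdivrMr ?mulr_gt0// mulrAC ler_pdivlMr//.
  rewrite mulrC; apply: le_trans H _.
  by rewrite le_eqVlt; apply/orP; left; apply/eqP; ring.
(* 864 = 24 * 6 * 6 comes from N >= m (n - m)/(24 n), y = (n - m)/(6 m) and 1 + y >= n/(6 m); it is
   relaxed to the square 900. *)
- apply: (@le_trans _ _ ((n%:R - m%:R) ^+ 2 / m%:R / 864)).
    have V0 : 0 < coupon_variance R n m by apply: coupon_variance_gt0; lia.
    have : coupon_variance R n m <= (n%:R - m%:R) ^+ 2 / m%:R.
      by apply: coupon_variance_le; lia.
    by move: (_ / m%:R) => W; lra.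
  have NR : m%:R * (n%:R - m%:R) <= 24 * N%:R * n%:R :> R.
    have : (m * (n - m) <= 24 * N * n)%N.
      apply: leq_trans (ltnW Nlt) _.
      have : (N.+1 * (12 * n) <= 2 * N * (12 * n))%N by rewrite leq_mul//; lia.
      by lia.
    by rewrite -(ler_nat R) !natrM natrB//; lia.
  have D0 : 0 <= n%:R - m%:R :> R by rewrite subr_ge0 ler_nat; lia.
  have y0 : 0 <= y by rewrite divr_ge0// mulr_ge0// ltW.
  apply: (@le_trans _ _ (N%:R * y * (n%:R / (6 * m%:R)))); last first.
    rewrite ler_wpM2l ?mulr_ge0//.
    rewrite -subr_ge0 /y.
    have -> : 1 + (n%:R - m%:R) / (6 * m%:R) - n%:R / (6 * m%:R) = 5 / 6 :> R.
      by field; rewrite gt_eqF.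
    by rewrite divr_ge0.
  rewrite -subr_ge0 /y.
  have -> : N%:R * ((n%:R - m%:R) / (6 * m%:R)) * (n%:R / (6 * m%:R)) -
      (n%:R - m%:R) ^+ 2 / m%:R / 864 =
    (n%:R - m%:R) / (864 * m%:R ^+ 2) *
    (24 * N%:R * n%:R - m%:R * (n%:R - m%:R)) :> R.
    by field; rewrite gt_eqF.
  apply: mulr_ge0; last by rewrite subr_ge0.
  by apply: (divr_ge0 D0); apply: mulr_ge0; [exact: ler0n|exact: sqr_ge0].
Qed.

End coupon_excess.

(** * The l1 estimate for m at least 24 *)

Section coupon_l1.
Context (R : realType).
Variables (n m f : nat) (a : R).
Hypotheses (m24 : (24 <= m)%N) (mn : (m + 4 <= n)%N).
Hypothesis aE : a = \sum_(x <- excesses R n m) x ^+ 2 - f%:R.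
Hypothesis a01 : 0 <= a < 1.

Let s := excesses R n m.
Let V := coupon_variance R n m.
Let sigma := Num.sqrt V.

Let V_gt0 : 0 < V.
Proof. by apply: coupon_variance_gt0; lia. Qed.

Let sigma_gt0 : 0 < sigma.
Proof. by rewrite sqrtr_gt0. Qed.

Let sigma2 : sigma ^+ 2 = V.
Proof. by rewrite sqr_sqrtr// ltW. Qed.

Let m_gt0 : 0 < m%:R :> R.
Proof. by rewrite ltr0n (leq_trans _ m24). Qed.

Let mltn : (m < n)%N.
Proof. by apply: leq_trans mn; rewrite addnS ltnS leq_addr. Qed.

Let D_gt0 : 0 < n%:R - m%:R :> R.
Proof. by rewrite subr_gt0 ltr_nat. Qed.

(** Here m (n - m) < 12 n, which with m >= 24 forces n - m < 24. The bound 225 = 15^2 is what makes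
    sigma/30 <= 1/2. *)
Lemma small_variance_le : ((m * (n - m)) %/ (12 * n) = 0)%N -> V <= 225.
Proof.
move=> N0; have nm24 : (n - m < 24)%N.
  have : (m * (n - m) < 12 * n)%N.
    have := ltn_ceil (m * (n - m)) (_ : 0 < 12 * n)%N.
    by rewrite N0 mul1n; apply; rewrite muln_gt0 (leq_ltn_trans _ mltn).
  have [D nE] : exists D, n = (m + D)%N by exists (n - m)%N; rewrite subnKC// ltnW.
  rewrite nE addKn => H; rewrite ltnNge; apply/negP => H24.
  have : (24 * m <= m * D)%N by rewrite mulnC leq_mul.
  have : (24 * D <= m * D)%N by rewrite leq_mul.
  by move: H; rewrite mulnDr; move: (m * D)%N => E; lia.
apply: (@le_trans _ _ ((n%:R - m%:R) ^+ 2 / m%:R)).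
  by apply: coupon_variance_le; [exact: leq_trans m24|exact: ltnW].
rewrite ler_pdivrMr//.
have D24 : n%:R - m%:R <= 24%:R :> R by rewrite -natrB ?ler_nat ltnW.
have m24R : 24%:R <= m%:R :> R by rewrite ler_nat.
by move: (n%:R - m%:R) D_gt0 D24 m24R => D; move: (m%:R : R) => M; nra.
Qed.

(** The variance is M plus the sum of squares a + f. Either that sum is below 1 and at most M, or f
    >= 1 and a + f <= 2 f. *)
Lemma half_variance_le : V / 2 <= \sum_(x <- s) x + f%:R.
Proof.
have /andP[a0 a1] := a01.
have M0 : 0 <= \sum_(x <- s) x.
  by rewrite big_seq sumr_ge0// => x; exact: excesses_ge0.
have VE : V = \sum_(x <- s) x + \sum_(x <- s) x ^+ 2 by exact: sum_excesses_var.
have S2E : \sum_(x <- s) x ^+ 2 = a + f%:R by rewrite aE subrK.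
have [S1|S1] := ltP (\sum_(x <- s) x ^+ 2) 1.
  have := sum_excesses_sqr_le S1; rewrite -/s => S2M.
  have : 0 <= f%:R :> R by [].
  by lra.
have : 1 <= f%:R :> R.
  case: (posnP f) S2E S1 => [-> | f0 _ _]; last by rewrite ler1n.
  by move=> -> ; rewrite mulr0n => ?; lra.
by lra.
Qed.

Lemma coupon_l1_leW3 t : 0 <= t <= 1 ->
  l1_le (fpsW ^+ 3 * smooth_part s f a t) (expR 2 * (30 / sigma) ^+ 3).
Proof.
move=> t01; have /andP[t0 t1] := t01.
have a01' : 0 <= a <= 1 by case/andP: a01 => -> /ltW ->.
have -> : 30 / sigma = (sigma / 30)^-1 by rewrite invf_div.
(* r^2 = V/900 is the bound supplied by [excesses_split]; it is also below V/12, as the Poisson case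
   requires. *)
set r := sigma / 30.
have r0 : 0 < r by rewrite divr_gt0.
have rV : r ^+ 2 = V / 900.
  by rewrite /r expr_div_n sigma2; congr (_ / _); rewrite -natrX.
have s0 : forall x, x \in s -> 0 <= x by move=> x; exact: excesses_ge0.
have [t2|t2] := lerP t 2^-1.
  apply: l1_leW3_half_left => //; last by rewrite t0.
  by have := half_variance_le; have := V_gt0; rewrite rV; lra.
have [N0|N0] := posnP ((m * (n - m)) %/ (12 * n))%N.
  apply: l1_leW3_trivial => //.
  have V225 := small_variance_le N0.
  have : r ^+ 2 <= 2^-1 ^+ 2 by rewrite rV; lra.
  by rewrite ler_pXn2r ?nnegrE// ?invr_ge0 ?(ltW r0).
have [u [v [sE su yu VN]]] := @excesses_split R n m m24 mn N0.
have y0 : 0 < (n%:R - m%:R) / (6 * m%:R) :> R.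
  by apply: divr_gt0 => //; apply: mulr_gt0.
apply: (l1_leW3_half_right f s0 a01' r0 sE su y0 yu _ _); first by rewrite rV.
by rewrite t1 ltW.
Qed.

Lemma coupon_l1_le :
  l1_le (interp s f a 1 - interp s f a 0)
    (30 ^+ 3 * expR 2 / sigma *
      (f%:R / V + (n%:R - m%:R) ^+ 2 / (n%:R * m%:R))).
Proof.
have s0 : forall x, x \in s -> 0 <= x by move=> x; exact: excesses_ge0.
apply: (l1_le_trans _ (interp_l1_le s0 aE coupon_l1_leW3)).
have S3 := @sum_excesses_cube_le R n m (ltn_trans (ltn0Sn _) m24) _.
rewrite -/s -/V in S3.
have {}S3 := S3 mltn.
set Q := (n%:R - m%:R) ^+ 2 / _ in S3 *.
(* V/sigma^3 = 1/sigma splits (Q V + f)/sigma^3 into the two terms of the claim. *)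
have -> : 30 ^+ 3 * expR 2 / sigma * (f%:R / V + Q) =
    (Q * V + f%:R) * (expR 2 * (30 / sigma) ^+ 3).
  rewrite -sigma2; field; exact: lt0r_neq0.
rewrite ler_wpM2r ?lerD2r// mulr_ge0 ?expR_ge0// exprn_ge0// divr_ge0//.
exact: ltW.
Qed.

End coupon_l1.

(** For small m the claimed bound exceeds the trivial bound 1: sigma is at most (n - m)/sqrt m,
    while (n - m)^2/(n m) is of order n - m. *)
Lemma coupon_trivial_bound (R : realType) (n m f : nat) :
  (2 <= m < 24)%N -> (m + 4 <= n)%N ->
  1 <= 30 ^+ 3 * expR 2 / Num.sqrt (coupon_variance R n m) *
    (f%:R / coupon_variance R n m + (n%:R - m%:R) ^+ 2 / (n%:R * m%:R)).
Proof.
move=> /andP[m2 m24] mn.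
set V := coupon_variance R n m.
have V0 : 0 < V by apply: coupon_variance_gt0; lia.
have m0 : 0 < m%:R :> R by rewrite ltr0n; lia.
have n0 : 0 < n%:R :> R by rewrite ltr0n; lia.
have D0 : 0 < n%:R - m%:R :> R by rewrite subr_gt0 ltr_nat; lia.
have s0 : 0 < Num.sqrt V by rewrite sqrtr_gt0.
have e1 : 1 <= expR 2 :> R by rewrite -expR0 ler_expR.
rewrite mulrAC ler_pdivlMr// mul1r.
set Q := (n%:R - m%:R) ^+ 2 / (n%:R * m%:R).
have Q0 : 0 <= Q by rewrite divr_ge0 ?sqr_ge0// mulr_ge0 ?ltW.
apply: (@le_trans _ _ (30 ^+ 3 * Q)); last first.
  apply: ler_pM => //; last by rewrite lerDr divr_ge0// ltW.
  by rewrite ler_peMr.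
have -> : 30 ^+ 3 * Q = Num.sqrt ((30 ^+ 3 * Q) ^+ 2).
  by rewrite sqrtr_sqr ger0_norm// mulr_ge0.
rewrite ler_wsqrtr//.
apply: (@le_trans _ _ ((n%:R - m%:R) ^+ 2 / m%:R)).
  by apply: coupon_variance_le; lia.
(* n - m >= 4 and m <= 23 give m <= 6 (n - m). *)
have nD : n%:R <= 7 * (n%:R - m%:R) :> R.
  by rewrite -natrB -?natrM ?ler_nat; lia.
have m23 : m%:R <= 23 :> R by rewrite (ler_nat _ m 23); lia.
have nm : n%:R ^+ 2 * m%:R <= (30 ^+ 3) ^+ 2 * (n%:R - m%:R) ^+ 2 :> R.
  apply: (@le_trans _ _ ((7 * (n%:R - m%:R)) ^+ 2 * 23)).
    apply: ler_pM => //; rewrite ?sqr_ge0//.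
    by rewrite ler_pXn2r// nnegrE ?ltW// mulr_gt0.
  have := sqr_ge0 (n%:R - m%:R : R); rewrite exprMn.
  by move: ((n%:R - m%:R) ^+ 2) => W; lra.
rewrite -subr_ge0 /Q.
have -> : (30 ^+ 3 * ((n%:R - m%:R) ^+ 2 / (n%:R * m%:R))) ^+ 2 -
   (n%:R - m%:R) ^+ 2 / m%:R =
   (n%:R - m%:R) ^+ 2 / (n%:R * m%:R) ^+ 2 *
   ((30 ^+ 3) ^+ 2 * (n%:R - m%:R) ^+ 2 - n%:R ^+ 2 * m%:R) :> R.
  by field; rewrite !gt_eqF.
by rewrite mulr_ge0 ?subr_ge0// divr_ge0 ?sqr_ge0.
Qed.

(** * The law of the waiting time *)

Section words.
Variable n : nat.

(** Words grow on the right, so that recursion on the length conditions on the latest draw. *)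
Fixpoint words (t : nat) : seq (seq nat) :=
  if t is t'.+1 then [seq rcons s k | s <- words t', k <- iota 0 n]
  else [:: [::]].

Lemma words_letters t s : s \in words t -> all (fun k => (k < n)%N) s.
Proof.
elim: t s => [|t IH] s; first by rewrite inE => /eqP ->.
move=> /allpairsP[[u k] /= [/IH ut]]; rewrite mem_iota => kn ->.
by rewrite all_rcons ut andbT.
Qed.

Lemma words_size t s : s \in words t -> size s = t.
Proof.
elim: t s => [|t IH] s; first by rewrite inE => /eqP ->.
by move=> /allpairsP[[u k] /= [/IH ut _ ->]]; rewrite size_rcons ut.
Qed.

Lemma size_undup_rcons (s : seq nat) k :
  size (undup (rcons s k)) = (size (undup s) + (k \notin s))%N.
Proof.
have /perm_size -> : perm_eq (undup (rcons s k)) (undup (k :: s)).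
  by apply: perm_undup => i; rewrite mem_rcons.
by rewrite /=; case: ifP => ks; rewrite ?addn0 //= addn1.
Qed.

Lemma count_old_letters (s : seq nat) : all (fun k => (k < n)%N) s ->
  count (mem s) (iota 0 n) = size (undup s).
Proof.
move=> sn; rewrite -size_filter; apply/perm_size/uniq_perm.
- by rewrite filter_uniq ?iota_uniq.
- exact: undup_uniq.
- move=> k; rewrite mem_filter mem_undup mem_iota /=.
  by have [/(allP sn) ->|] := boolP (k \in s).
Qed.

Lemma count_new_letters (s : seq nat) : all (fun k => (k < n)%N) s ->
  count (predC (mem s)) (iota 0 n) = (n - size (undup s))%N.
Proof.
move=> sn; rewrite -(count_old_letters sn).
by rewrite -[X in (X - _)%N](size_iota 0 n) -(count_predC (mem s)) addKn.
Qed.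

(** Of the n possible next letters, D repeat an old one and n - D are new: one transition of the
    chain counting distinct coupons. *)
Lemma sum_next_letter (s : seq nat) (G : nat -> nat) :
  all (fun k => (k < n)%N) s -> let D := size (undup s) in
  (\sum_(k <- iota 0 n) G (size (undup (rcons s k))) =
   D * G D + (n - D) * G D.+1)%N.
Proof.
move=> sn D.
have sumb (b : pred nat) : (\sum_(k <- iota 0 n) b k = count b (iota 0 n))%N.
  by rewrite -sum1_count [RHS]big_mkcond; apply: eq_bigr => k _; case: (b k).
rewrite (eq_bigr (fun k => (k \in s) * G D + (k \notin s) * G D.+1)%N); last first.
  move=> k _; rewrite size_undup_rcons -/D.
  by case: (k \in s); rewrite /= ?addn0 ?addn1 mul1n ?mul0n ?addn0 ?add0n.
rewrite big_split /= -!big_distrl /=.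
rewrite (sumb (mem s)) (sumb (predC (mem s))).
by rewrite count_old_letters// count_new_letters.
Qed.

Definition num_words t r := (\sum_(s <- words t) (size (undup s) == r))%N.

Lemma sum_words_rcons t (F : seq nat -> nat) :
  (\sum_(s <- words t.+1) F s = \sum_(s <- words t) \sum_(k <- iota 0 n) F (rcons s k))%N.
Proof. by rewrite /= big_allpairs_dep. Qed.

Lemma num_wordsS t r : num_words t.+1 r =
  (r * num_words t r + (if r is r'.+1 then (n - r') * num_words t r' else 0))%N.
Proof.
rewrite /num_words sum_words_rcons big_seq.
under eq_bigr => s st do
  rewrite (sum_next_letter (fun d => d == r : nat) (words_letters st)).
rewrite -big_seq big_split /=; congr (_ + _)%N.
  rewrite big_distrr /=; apply: eq_bigr => s _.
  by case: eqP => [->|]; rewrite ?muln0.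
case: r => [|r]; first by rewrite big1// => s _; rewrite muln0.
rewrite big_distrr /=; apply: eq_bigr => s _.
by rewrite eqSS; case: eqP => [->|]; rewrite ?muln0.
Qed.

Lemma num_words_new t r :
  (\sum_(s <- words t) \sum_(k <- iota 0 n)
     ((size (undup s) == r) && (size (undup (rcons s k)) == r.+1)) =
   (n - r) * num_words t r)%N.
Proof.
rewrite /num_words big_seq big_distrr /= [RHS]big_seq; apply: eq_bigr => s st.
rewrite (eq_bigr (fun k => (size (undup s) == r) * (size (undup (rcons s k)) == r.+1))%N);
  last by move=> k _; rewrite mulnb.
rewrite -big_distrr /=.
rewrite (sum_next_letter (fun d => d == r.+1 : nat) (words_letters st)).
case: eqP => [->|]; last by rewrite mul0n muln0.
by rewrite eqxx (ltn_eqF (ltnSn r)) muln0 add0n mul1n.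
Qed.

End words.

(** * Generating functions of the collection times *)

Section hitting_series.
Context (R : realType) (n : nat).
Hypothesis n_gt0 : (0 < n)%N.

Let n0 : n%:R != 0 :> R.
Proof. by rewrite pnatr_eq0 -lt0n. Qed.

(* Coefficient t: the probability that t draws show exactly r coupons. *)
Definition occupancy r : fps R := fun t => (num_words n t r)%:R / n%:R ^+ t.

(* Coefficient t: the probability that draw t shows the (r + 1)-st new coupon. *)
Definition hitting r : fps R := fps_const ((n - r)%:R / n%:R) * (fpsX * occupancy r).

Lemma occupancy0 : occupancy 0 = 1.
Proof.
apply/funext => t; rewrite /occupancy fps1.
case: t => [|t]; first by rewrite /num_words /= big_seq1 /= expr0 divr1.
by rewrite num_wordsS mul0n addn0 mul0r.
Qed.

Lemma occupancyS r :
  occupancy r.+1 = hitting r + fps_const (r.+1%:R / n%:R) * (fpsX * occupancy r.+1).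
Proof.
apply/funext => t; rewrite fpsD /hitting !fps_constM !fpsXM /occupancy.
case: t => [|t]; first by rewrite /num_words big_seq1 /= mul0r !mulr0 addr0.
rewrite num_wordsS natrD !natrM exprS; field.
by rewrite n0 expf_neq0.
Qed.

(** When k labels are missing, the next new coupon costs one successful draw, the factor z, and a
    geometric number of repeats with mean n/k - 1. *)
Lemma hitting_prod r : (r < n)%N -> hitting r =
  fpsX ^+ r.+1 * \prod_((n - r)%N <= k < n.+1) geom_fps (excess R n k).
Proof.
elim: r => [_|r IH rn].
  rewrite /hitting occupancy0 subn0 divff// rmorph1 mul1r mulr1 expr1.
  by rewrite big_nat1 /excess divff// subrr geom_fps0 mulr1.
have {}IH := IH (ltnW rn).
have nr : (n - r = (n - r.+1).+1)%N by rewrite subnSK// ltnW.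
rewrite nr in IH.
rewrite big_ltn; last by rewrite ltnS leq_subr.
rewrite exprS mulrACA -IH.
set k := (n - r.+1)%N; set g := geom_fps _.
have k0 : k%:R != 0 :> R by rewrite pnatr_eq0 -lt0n subn_gt0.
have rE : r.+1%:R = n%:R - k%:R :> R by rewrite /k natrB ?subKr// ltnW.
have K : (1 - fps_const (excess R n k) * fpsW) * g = 1.
  by rewrite geom_fpsK// /excess subrKC mulf_neq0 ?invr_neq0.
have := occupancyS r; set H := hitting r.
rewrite /hitting -/k; set A := occupancy r.+1 => AE.
suff E : fps_const (k%:R / n%:R) * A = g * H by rewrite mulrCA E mulrA.
have -> : H = (1 - fps_const (r.+1%:R / n%:R) * fpsX) * A.
  by rewrite mulrBl mul1r -mulrA {1}AE addrK.
(* Rewriting the recursion factor in w, with k = n - (r + 1) labels missing, exposes the inverse of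
   [G_x] for x = n/k - 1. *)
have -> : 1 - fps_const (r.+1%:R / n%:R) * fpsX =
    fps_const (k%:R / n%:R) * (1 - fps_const (excess R n k) * fpsW).
  rewrite mulrBr mulr1 mulrA -rmorphM.
  have -> : k%:R / n%:R * excess R n k = r.+1%:R / n%:R.
    by rewrite rE /excess; field; rewrite n0 k0.
  have -> : k%:R / n%:R = 1 - r.+1%:R / n%:R :> R by rewrite rE; field.
  by rewrite rmorphB rmorph1 /fpsW; ring.
by rewrite -[LHS]mul1r -{1}K; ring.
Qed.

End hitting_series.

Lemma sum_measure_le (R : realType) (d : measure_display) (T : measurableType d)
    (mu : {measure set T -> \bar R}) (n : nat) (F : nat -> set T) (E : set T) :
  (forall i, measurable (F i)) -> trivIset setT F -> measurable E ->
  (forall i, (i < n)%N -> F i `<=` E)%classic ->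
  (\sum_(i < n) mu (F i) <= mu E)%E.
Proof.
move=> mF tF mE FE; rewrite -measure_semi_additive_ord_I//.
- apply: le_measure; rewrite ?inE//; first exact: bigsetU_measurable.
  by rewrite -bigcup_mkord => x [i /= /FE]; exact.
- exact: sub_trivIset tF.
- exact: bigsetU_measurable.
Qed.

Lemma mkseq_cons (T : Type) (f : nat -> T) l :
  mkseq f l.+1 = f 0%N :: mkseq (fun i => f i.+1) l.
Proof. by rewrite /mkseq /= (iotaDl 1 0) -map_comp. Qed.

(** * From words to the probability space *)

Section draws.
Context (R : realType) (d : measure_display) (T : measurableType d)
  (P : probability T R) (n : nat) (X : nat -> {RV P >-> nat}).
Hypothesis Xdraws : coupon_draws n X.
Hypothesis n_gt0 : (0 < n)%N.

Local Notation x_ w := (fun i => X i w).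

Definition word_event (t : nat) (Q : pred (seq nat)) (u : seq nat) : set T :=
  [set w | Q (mkseq (x_ w) t) && (mkseq (fun i => X (t + i)%N w) (size u) == u)]%classic.

Lemma measurable_word_event t Q u : measurable (word_event t Q u).
Proof.
have := measurable_word X (t + size u)
  [pred v | Q (take t v) && (drop t v == u)].
congr (measurable _); apply/seteqP; split => w /=;
  by rewrite /mkseq iotaD map_cat take_size_cat ?size_map ?size_iota//
     drop_size_cat ?size_map ?size_iota// add0n -[in iota t _](addn0 t) iotaDl -map_comp.
Qed.

(* The induction on t strips the last letter of the word; u collects the letters
   already stripped. *)
Lemma word_prob_ge t (Q : pred (seq nat)) (u : seq nat) :
  all (fun k => (k < n)%N) u ->
  (((\sum_(s <- words n t) Q s)%:R / n%:R ^+ (t + size u))%:E <=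
   P (word_event t Q u))%E.
Proof.
have [indep law] := Xdraws.
elim: t Q u => [|t IH] Q u un.
  rewrite big_seq1; have [Q0|_] := boolP (Q [::]); last first.
    by rewrite mul0r measure_ge0.
  rewrite mul1r.
  have -> : word_event 0 Q u =
      (\bigcap_(i in [set` iota 0 (size u)]) (X i @^-1` [set nth 0%N u i]))%classic.
    apply/seteqP; split => w; rewrite /word_event /= Q0 /=.
      move=> /eqP uE i /=; rewrite mem_iota /= => iu.
      by rewrite -[in RHS]uE nth_mkseq.
    move=> H; apply/eqP/(@eq_from_nth _ 0%N); rewrite size_mkseq// => i iu.
    by rewrite nth_mkseq//; apply: H; rewrite /= mem_iota.
  rewrite (indep _ (fun i => [set nth 0%N u i]%classic)) ?iota_uniq//.
  rewrite (eq_big_seq (fun=> (n%:R^-1)%:E)); last first.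
    move=> i; rewrite mem_iota /= => iu.
    by rewrite law (allP un)// mem_nth.
  rewrite prodEFin lee_fin.
  have := prodr_const_nat 0 (size u) (n%:R^-1 : R).
  by rewrite /index_iota subn0 => ->; rewrite exprVn.
(* One event per value k of the draw with index t, moved from the word to the front of u; these are
   disjoint parts of the original event. *)
pose F k := word_event t (fun s => Q (rcons s k)) (k :: u).
have Fk k w : F k w -> X t w = k /\ word_event t.+1 Q u w.
  rewrite /F /word_event /= mkseq_cons addn0 eqseq_cons => /and3P[Qk /eqP Xk uE].
  rewrite -Xk in Qk *.
  split => //; rewrite mkseqS Qk (eq_mkseq (g := fun i => X (t + i.+1)%N w))//.
  by move=> i; rewrite addSnnS.
have tF : trivIset setT F.
  by move=> i j _ _ [w [/Fk[<- _] /Fk[<- _]]].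
have FE i : (i < n)%N -> (F i `<=` word_event t.+1 Q u)%classic.
  by move=> _ w /Fk[].
apply: le_trans (sum_measure_le P (fun i => measurable_word_event _ _ _) tF
  (measurable_word_event _ _ _) FE).
apply: (@le_trans _ _ (\sum_(k < n)
    ((\sum_(s <- words n t) Q (rcons s k))%N%:R /
     n%:R ^+ (t + size (nat_of_ord k :: u)))%:E)%E).
  rewrite sumEFin lee_fin /= -mulr_suml -natr_sum addSnnS.
  rewrite sum_words_rcons exchange_big /= -(big_mkord xpredT (fun k =>
     (\sum_(s <- words n t) Q (rcons s k))%N)).
  by rewrite /index_iota subn0.
by apply: lee_sum => k _; apply: IH; rewrite /= ltn_ord.
Qed.

(** The number of distinct labels never decreases, so the value reached by a new letter cannot occur
    earlier. Index t is draw number t + 1. *)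
Lemma first_time_new_letter (x : nat -> nat) t :
  x t \notin mkseq x t -> first_time x (num_distinct x t).+1 = t.+1.
Proof.
move=> xt; rewrite /first_time.
have Dt : num_distinct x t.+1 = (num_distinct x t).+1.
  by rewrite /num_distinct mkseqS size_undup_rcons xt addn1.
case: pselect => [e|]; last by case; exists t.+1; rewrite Dt.
case: ex_minnP => k /eqP kE kmin; apply/eqP; rewrite eqn_leq kmin ?Dt//=.
rewrite ltnNge; apply/negP => kt.
have : (num_distinct x k <= num_distinct x t)%N.
  apply: uniq_leq_size; first exact: undup_uniq.
  move=> i; rewrite !mem_undup => /mapP[j]; rewrite mem_iota /= add0n => jk ->.
  by apply/mapP; exists j => //; rewrite mem_iota /= add0n (leq_trans jk).
by rewrite kE ltnn.
Qed.

Lemma waiting_time_prob_ge (m t : nat) : (m < n)%N ->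
  ((hitting R n (n - m.+1) t)%:E <=
   P [set w | waiting_time X n m w = t%:R :> R]%classic)%E.
Proof.
move=> mn; set r := (n - m.+1)%N.
have mW : measurable [set w | waiting_time X n m w = t%:R :> R]%classic.
  rewrite -[X in measurable X]setTI.
  exact: (measurable_waiting_time X n m measurableT (measurable_set1 (t%:R : R))).
have rE : (n - m = r.+1)%N by rewrite /r subnSK.
case: t mW => [|t] mW.
  by rewrite /hitting fps_constM fpsXM mulr0 measure_ge0.
(* The words whose last letter is the (r + 1)-st new one; r + 1 = n - m. *)
pose Q := [pred v : seq nat | (size (undup (take t v)) == r) && (size (undup v) == r.+1)].
have := @word_prob_ge t.+1 Q [::] isT.
rewrite sum_words_rcons addn0.
have -> : (\sum_(s <- words n t) \sum_(k <- iota 0 n) Q (rcons s k) =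
    (n - r) * num_words n t r)%N.
  rewrite -num_words_new big_seq [RHS]big_seq; apply: eq_bigr => s st.
  apply: eq_bigr => k _; rewrite /Q /= -cats1 take_size_cat ?cats1//.
  by rewrite (words_size st).
have -> : ((n - r) * num_words n t r)%N%:R / n%:R ^+ t.+1 = hitting R n r t.+1 :> R.
  rewrite /hitting fps_constM fpsXM /occupancy natrM exprS.
  by field; rewrite expf_neq0 pnatr_eq0 -lt0n.
move=> /le_trans; apply; apply: le_measure; rewrite ?inE//.
  exact: measurable_word_event.
move=> w /andP[+ _]; rewrite mkseqS => /andP[].
rewrite size_undup_rcons -cats1 take_size_cat ?size_mkseq// => /eqP Dt.
rewrite Dt.
have [_|new _] := boolP (X t w \in mkseq (x_ w) t).
  by rewrite addn0 ltn_eqF.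
by rewrite /waiting_time /= rE -Dt (first_time_new_letter new).
Qed.

End draws.

(** * Total variation *)

Section total_variation.
Context (R : realType).
Implicit Types (mu nu : probability R R) (B : set R) (K : R).

Lemma dTV_le mu nu K :
  (forall B, measurable B -> nu B <= mu B + K%:E)%E -> (dTV mu nu <= K%:E)%E.
Proof.
move=> H; apply: ge_ereal_sup => _ [B mB <-].
have := H _ mB; have := H _ (measurableC mB).
rewrite !probability_setC//.
have /fineK <- : (mu B \is a fin_num)%E by exact: fin_num_measure.
have /fineK <- : (nu B \is a fin_num)%E by exact: fin_num_measure.
move: (fine _) (fine _) => y x.
rewrite -!EFinB -!EFinD !lee_fin => H1 H2.
by rewrite ler_norml; lra.
Qed.

Lemma dTV_le1 mu nu K : 1 <= K -> (dTV mu nu <= K%:E)%E.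
Proof.
move=> K1; apply: dTV_le => B mB.
apply: (@le_trans _ _ 1%E); first exact: probability_le1.
by rewrite -[leLHS]add0e leeD// ?measure_ge0// lee_fin.
Qed.

(* Passing to complements turns the one-sided bound of [dTV_le] into a two-sided
   one, so no upper bound for the point masses of [mu] is needed. *)
Lemma dTV_le_l1 mu nu (p q : fps R) K :
  (forall i : nat, (p i)%:E <= mu [set i%:R]%classic)%E ->
  (forall i : nat, nu [set i%:R]%classic <= (q i)%:E)%E ->
  (forall B, nu B = nu (B `&` range (fun i : nat => i%:R : R))%classic) ->
  l1_le (p - q) K -> (dTV mu nu <= K%:E)%E.
Proof.
move=> pmu nuq nuN pqK; apply: dTV_le => B mB.
pose A (i : nat) : set R := (B `&` [set i%:R])%classic.
have mA i : measurable (A i) by apply: measurableI => //; exact: measurable_set1.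
have tA : trivIset setT A.
  move=> i j _ _ [x [[_ /= xi] [_ /= xj]]].
  by apply/eqP; rewrite -(eqr_nat R) -xi xj.
have mBN : measurable (B `&` range (fun i : nat => i%:R : R))%classic.
  rewrite (_ : (_ `&` _)%classic = \bigcup_i A i)%classic; first exact: bigcup_measurable.
  apply/seteqP; split => [x [Bx [i _ ix]]|x [i _ [Bx ix]]].
    by exists i.
  by split => //; exists i.
have nuA : (nu (B `&` range (fun i : nat => i%:R : R))%classic <=
    \sum_(0 <= i <oo) nu (A i))%E.
  apply: measure_sigma_subadditive => // x [Bx [i _ ix]].
  by exists i.
rewrite nuN; apply: (le_trans nuA).
apply: lime_le; first by apply: is_cvg_nneseries => i _ _; exact: measure_ge0.
apply: nearW => J; rewrite big_mkord.
have muJ : (\sum_(i < J) mu (A i) <= mu B)%E.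
  by apply: sum_measure_le => // i _ x [].
apply: (@le_trans _ _ (\sum_(i < J) mu (A i) + K%:E)%E); last exact: leeD.
apply: (@le_trans _ _ (\sum_(i < J) (mu (A i) + `|(p - q) i|%:E))%E).
  apply: lee_sum => i _.
  have [iB|iB] := pselect (B (i%:R)); last first.
    have -> : A i = set0 by apply/seteqP; split => // x [Bx /= xi]; rewrite xi in Bx.
    by rewrite !measure0 add0e lee_fin.
  have -> : A i = [set i%:R]%classic.
    by apply/seteqP; split => [x []//|x /= ->]; split.
  apply: le_trans (nuq i) _; apply: (@le_trans _ _ ((p i)%:E + `|(p - q) i|%:E)%E).
    rewrite -EFinD lee_fin fpsB.
    by rewrite -lerBlDl -normrN opprB ler_norm.
  exact: leeD.
by rewrite big_split /= leeD// sumEFin lee_fin; exact: pqK.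
Qed.

End total_variation.

(** * Point masses of the approximating law *)

Section compound_poisson.
Context (R : realType).
Implicit Types (a mu : R).

Lemma poisson_prob_set1 a k : 0 <= a ->
  poisson_prob a 0 [set k]%classic = (poisson_fps a k)%:E.
Proof.
rewrite le_eqVlt => /predU1P[<-|a0]; rewrite /poisson_prob ?ltxx ?a0.
  rewrite poisson_fps0 fps1 diracE; congr ((nat_of_bool _)%:R%:E)%E.
  by apply/idP/eqP => [|->]; rewrite inE//= => ->.
rewrite esum_set1 ?lee_fin ?poisson_pmf_ge0//.
by rewrite /poisson_pmf a0.
Qed.

Lemma pi_law_set1_le mu a (i : nat) : 0 <= mu -> 0 <= a ->
  (pi_law mu a [set i%:R]%classic <=
   ((poisson_fps mu * fps_dilate2 (poisson_fps (a / 2))) i)%:E)%E.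
Proof.
move=> mu0 a0; have a20 : 0 <= a / 2 by rewrite divr_ge0.
(* l is the contribution of twice the second variable, so odd l give the empty set, matching the
   zero odd coefficients of [fps_dilate2]. *)
pose F (l : nat) : set (nat * nat) :=
  (if odd l then set0 else [set (i - l)%N] `*` [set l./2])%classic.
have mF l : measurable (F l).
  by rewrite /F; case: ifP => // _; apply: measurableX.
have sub : (@sum_twice R @^-1` [set i%:R] `<=` \big[setU/set0]_(l < i.+1) F l)%classic.
  move=> [u v] /= /eqP; rewrite /sum_twice eqr_nat /= => /eqP uv.
  rewrite -bigcup_mkord; exists (2 * v)%N => /=; first by rewrite ltnS -uv leq_addl.
  by rewrite /F mul2n odd_double /= doubleK -mul2n -uv addnK.
have mS : measurable (@sum_twice R @^-1` [set i%:R])%classic.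
  by rewrite -[X in measurable X]setTI; exact: measurable_sum_twice.
have := @content_subadditive _ _ _
  (poisson_prob mu 0 \x poisson_prob (a / 2) 0)%E _ F i.+1 (fun l _ => mF l) mS sub.
move=> /le_trans; apply.
rewrite fpsM (reindex_inj rev_ord_inj) /= -sumEFin.
apply: lee_sum => l _; rewrite /F /fps_dilate2.
rewrite subSS; case: ifP => _; first by rewrite measure0 mulr0.
have li : (l <= i)%N by rewrite -ltnS.
have E := product_measure1E (poisson_prob mu 0) (poisson_prob (a / 2) 0)
  (A1 := [set (i - (i - l))%N]%classic) (A2 := [set (i - l)./2]%classic) I I.
rewrite [leLHS]E (subKn li) EFinM -(poisson_prob_set1 _ mu0) -(poisson_prob_set1 _ a20).
exact: lexx.
Qed.

Lemma pi_law_nat mu a B : pi_law mu a B =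
  pi_law mu a (B `&` range (fun i : nat => i%:R : R))%classic.
Proof.
have E : (@sum_twice R @^-1` B = @sum_twice R @^-1`
    (B `&` range (fun i : nat => i%:R : R)))%classic.
  apply/seteqP; split => [z Bz|z []//].
  by split => //; exists (z.1 + 2 * z.2)%N.
exact: (congr1 (poisson_prob mu 0 \x poisson_prob (a / 2) 0)%E E).
Qed.

End compound_poisson.

Lemma fpsXnM (R : realType) (g : fps R) k j :
  (fpsX ^+ k * g) j = if (j < k)%N then 0 else g (j - k)%N.
Proof.
elim: k j => [|k IH] j; first by rewrite expr0 mul1r subn0.
by rewrite exprS -mulrA fpsXM; case: j => // j; rewrite IH ltnS subSS.
Qed.

Section main.
Context (R : realType) (d : measure_display) (T : measurableType d)
  (P : probability T R) (n m : nat) (X : nat -> {RV P >-> nat}).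
Hypotheses (mn : (m < n)%N) (Xdraws : coupon_draws n X).

Lemma shifted_waiting_time_ge (f i : nat) (c : R) :
  c = f%:R - (n%:R - m%:R) ->
  (((fpsX ^+ f * \prod_(x <- excesses R n m) geom_fps x) i)%:E <=
   distribution P (waiting_time X n m \+ cst c)%R [set i%:R]%classic)%E.
Proof.
(* W + c = i means W = i - f + (n - m); for i < f the coefficient is 0. *)
move=> cE; rewrite fpsXnM; case: ltnP => [_|fi]; first exact: measure_ge0.
have n0 : (0 < n)%N by exact: leq_trans mn.
have lt_rn : (n - m.+1 < n)%N by rewrite ltn_subrL.
have := waiting_time_prob_ge Xdraws n0 (i - f + (n - m)) mn.
rewrite hitting_prod// fpsXnM subnSK// ltnNge leq_addl /= addnK.
have -> : (n - (n - m.+1) = m.+1)%N by rewrite subKn.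
rewrite -(big_map (excess R n) xpredT (@geom_fps R)) => /le_trans; apply.
rewrite le_eqVlt; apply/orP; left; apply/eqP.
rewrite /distribution /pushforward; congr (P _).
apply/seteqP; split => w /=; rewrite /cst cE natrD !natrB// ?(ltnW mn)//.
  by move=> ->; ring.
by move=> H; rewrite -H; ring.
Qed.

End main.

Theorem theorem6p2p1 (R : realType) :
  exists C : R, 0 < C /\
    forall (n m : nat), (2 <= n)%N -> (2 <= m)%N -> (m + 4 <= n)%N ->
    forall (d : measure_display) (T : measurableType d) (P : probability T R)
      (X : nat -> {RV P >-> nat}), coupon_draws n X ->
    let mean := coupon_mean R n m in
    let var := coupon_variance R n m in
    let sigma := Num.sqrt var in
    let mu := var - 2 * fracR (var - mean) in
    let a := fracR (var - mean) in
    let c := floorR (var - mean) in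
    (dTV (distribution P (waiting_time X n m \+ cst c)%R) (pi_law mu a)
     <= (C / sigma *
          (floorR (var - (mean - (n%:R - m%:R))) / var +
           (n%:R - m%:R) ^+ 2 / (n%:R * m%:R)))%:E)%E.
Proof.
(* The exponential bounds the factors depending on a; 30^3 comes from three factors 30/sigma. *)
exists (30 ^+ 3 * expR 2); split; first by rewrite mulr_gt0 ?exprn_gt0 ?expR_gt0.
move=> n m _ m2 mn d T P X Xdraws; cbv zeta.
set mean := coupon_mean R n m; set var := coupon_variance R n m.
set mu := var - 2 * _; set a := fracR _; set c := floorR (var - mean).
have lt_mn : (m < n)%N by apply: leq_trans mn; rewrite addnS ltnS leq_addr.
pose s := excesses R n m.
have s0 : forall x, x \in s -> 0 <= x by move=> x; exact: excesses_ge0.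
pose M := \sum_(x <- s) x.
pose S2 := \sum_(x <- s) x ^+ 2.
have ME : M = mean - (n%:R - m%:R) by apply: sum_excesses_mean; exact: ltnW.
have varE : var = M + S2 by exact: sum_excesses_var.
have S20 : 0 <= S2 by apply: sumr_ge0 => x _; exact: sqr_ge0.
(* S2 = var - mean + (n - m) differs from var - mean by an integer, so the fractional part is the
   same a, and c = f - (n - m). *)
pose f := `|Num.floor S2|%N.
have fE : floorR S2 = f%:R.
  by rewrite /floorR /f natr_absz ger0_norm// floor_ge0.
have S2E : var - (mean - (n%:R - m%:R)) = S2 by rewrite varE -ME addrC addKr.
have cE : c = f%:R - (n%:R - m%:R).
  rewrite /c -fE /floorR.
  have -> : var - mean = S2 + (m%:R - n%:R) by rewrite -S2E; ring.
  rewrite floorDrz; last by rewrite rpredB ?natr_int.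
  rewrite rmorphD /= opprB; congr (_ + _).
  by rewrite floorK// rpredB ?natr_int.
have aE : a = S2 - f%:R by rewrite /a /fracR -/c cE -S2E; ring.
have a01 : 0 <= a < 1.
  rewrite aE -fE /floorR subr_ge0 floor_le ltrBlDl addrC.
  by have := floorD1_gt S2; rewrite rmorphD /= addrC.
have /andP[a0 a1] := a01.
have muE : mu = M + f%:R - a by rewrite /mu -/a varE aE; ring.
(* Either S2 < 1, and then a <= S2 <= M, or f >= 1 > a. *)
have mu0 : 0 <= mu.
  have M0 : 0 <= M by rewrite /M big_seq sumr_ge0.
  rewrite muE; have [S21|S21] := ltP S2 1.
    have S2M : S2 <= M by exact: sum_excesses_sqr_le.
    by rewrite aE; have : 0 <= f%:R :> R by []; lra.
  have : 1 <= f%:R :> R; last by lra.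
  by rewrite -fE /floorR ler1z floor_ge_int.
rewrite S2E fE.
have [m24|m24] := ltnP m 24.
  apply: dTV_le1; apply: coupon_trivial_bound => //; exact/andP.
apply: (@dTV_le_l1 _ _ _ (interp s f a 1) (interp s f a 0)).
- by move=> i; rewrite interp1; exact: shifted_waiting_time_ge.
- by move=> i; rewrite interp0 -muE; exact: pi_law_set1_le.
- by move=> B; exact: pi_law_nat.
- exact: coupon_l1_le.
Qed.
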